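(* Let $k$ be an algebraically closed field of characteristic zero, $V$ a finite-dimensional $k$-vector space, $G\subseteq \mathrm{SL}(V)$ a finite abelian subgroup, $R=k[V]$ and $S=R^G$. With $\Lambda$, $e$, $\varphi:S\hookrightarrow\Lambda$ and $R^{\widehat M}$ as in the context, the map $\varphi$ induces an isomorphism of algebras $$\varphi(S)\big/\sqrt{\varphi(S)\cap(\Lambda e\Lambda)}\;\cong\; R^{\widehat M}.$$
   Context: For a character $\chi:G\to k^*$ let $V_\chi$ be the corresponding one-dimensional representation and $M_\chi=(V_\chi\otimes R)^G$, an $S$-module (identified with $\{f\in R: g\cdot f=\chi(g)^{-1}f\ \forall g\in G\}$). Put $\widehat M=\bigoplus_\chi M_\chi$ (sum over all characters of $G$; $\widehat M\cong R$ as $S$-modules) and $\Lambda=\mathrm{End}_S(\widehat M)$. Let $e\in\Lambda$ be the idempotent projecting onto the summand $M_{\chi_0}=S$, where $\chi_0$ is the trivial character, and let $\varphi:S\hookrightarrow\Lambda$ be the injection given by the $S$-module structure of $\widehat M$. The contraction algebra is $\Lambda_{\mathrm{con}}=\Lambda/\Lambda e\Lambda$, and $R^{\widehat M}=Z(\Lambda_{\mathrm{con}})/\mathrm{nil}(Z(\Lambda_{\mathrm{con}}))$ is the reduced ring of its center. $\sqrt{\varphi(S)\cap(\Lambda e\Lambda)}$ is the radical of the ideal $\varphi(S)\cap\Lambda e\Lambda$ in the commutative ring $\varphi(S)$. The homomorphism in question is the one induced by $S\xrightarrow{\varphi}\Lambda\to\Lambda_{\mathrm{con}}$, whose image lies in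 $Z(\Lambda_{\mathrm{con}})$. *)

(* Defs.v *)
From HB Require Import structures.
From mathcomp Require Import all_boot all_order all_algebra.
From mathcomp Require Import finmap mpoly.
From mathcomp Require Import boolp.

Set Implicit Arguments.
Unset Strict Implicit.
Unset Printing Implicit Defensive.

Import GRing.Theory.
Local Open Scope ring_scope.
Local Open Scope quotient_scope.

(* Unital associative k-algebras, given by a ring morphism from k to the center.
   The zero ring is allowed, which algType excludes: the contraction algebra
   is zero when G is trivial. *)
Record pz_algebra (k : comPzRingType) := PzAlgebra {
  alg_ring :> pzRingType;
  alg_map : {rmorphism k -> alg_ring};
  alg_mapC : forall a x, alg_map a * x = x * alg_map a
}.

Definition algebra_iso (k : comPzRingType) (A B : pz_algebra k)
    (f : {rmorphism A -> B}) : Prop :=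
  (forall a : k, f (alg_map A a) = alg_map B a) /\ bijective f.

Section Subalgebras.
Variables (k : comPzRingType) (A : pz_algebra k).

Record subalgebra := Subalgebra {
  subalg_mem :> A -> Prop;
  subalgK : forall a : k, subalg_mem (alg_map A a);
  subalgB : forall x y, subalg_mem x -> subalg_mem y -> subalg_mem (x - y);
  subalgM : forall x y, subalg_mem x -> subalg_mem y -> subalg_mem (x * y)
}.

Definition subalg_pred (B : subalgebra) : pred A := fun x => `[< B x >].

Record subalg_type (B : subalgebra) := SubalgElt {
  subalg_val : A;
  _ : subalg_pred B subalg_val
}.

HB.instance Definition _ B := [isSub for @subalg_val B].
HB.instance Definition _ B := [Choice of subalg_type B by <:].

Fact subalg_subring_closed B : subring_closed (subalg_pred B).
Proof.
split=> [|x y|x y]; rewrite /in_mem /= /subalg_pred.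
- by apply/asboolP; rewrite -(rmorph1 (alg_map A)); exact: subalgK.
- by move=> /asboolP Bx /asboolP By; apply/asboolP; exact: subalgB.
- by move=> /asboolP Bx /asboolP By; apply/asboolP; exact: subalgM.
Qed.

HB.instance Definition _ B :=
  GRing.SubChoice_isSubPzRing.Build A (subalg_pred B) (subalg_type B)
    (subalg_subring_closed B).

Definition subalg_elt (B : subalgebra) (x : A) (Bx : B x) : subalg_type B :=
  SubalgElt (asboolT Bx).

Definition subalg_map (B : subalgebra) (a : k) : subalg_type B :=
  subalg_elt (subalgK B a).

Fact subalg_map_zmod B : zmod_morphism (subalg_map B).
Proof. by move=> a b; apply: val_inj; rewrite /= rmorphB. Qed.
Fact subalg_map_monoid B : monoid_morphism (subalg_map B).
Proof. by split=> [|a b]; apply: val_inj; rewrite /= ?rmorph1 ?rmorphM. Qed.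
HB.instance Definition _ B :=
  GRing.isZmodMorphism.Build k (subalg_type B) (subalg_map B) (subalg_map_zmod B).
HB.instance Definition _ B :=
  GRing.isMonoidMorphism.Build k (subalg_type B) (subalg_map B)
    (subalg_map_monoid B).

Fact subalg_mapC B a x : subalg_map B a * x = x * subalg_map B a.
Proof. by apply: val_inj; rewrite !rmorphM /= alg_mapC. Qed.

Definition subalg (B : subalgebra) : pz_algebra k :=
  @PzAlgebra k (subalg_type B) (subalg_map B) (@subalg_mapC B).

Definition center_mem (x : A) : Prop := forall y, x * y = y * x.

Fact center_memK a : center_mem (alg_map A a). Proof. exact: alg_mapC. Qed.
Fact center_memB x y : center_mem x -> center_mem y -> center_mem (x - y).
Proof. by move=> Zx Zy z; rewrite mulrBl mulrBr Zx Zy. Qed.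
Fact center_memM x y : center_mem x -> center_mem y -> center_mem (x * y).
Proof. by move=> Zx Zy z; rewrite -mulrA Zy mulrA Zx mulrA. Qed.

Definition center : subalgebra := Subalgebra center_memK center_memB center_memM.

Fact center_mulC : commutative ( *%R : subalg center -> _ -> _).
Proof.
by move=> x y; apply: val_inj; rewrite !rmorphM; case: x => x /= /asboolP ->.
Qed.

End Subalgebras.

Section Ideals.
Variable A : pzRingType.

(* Two-sided ideals, not necessarily proper. *)
Record ideal := Ideal {
  ideal_mem :> A -> Prop;
  ideal0 : ideal_mem 0;
  idealD : forall x y, ideal_mem x -> ideal_mem y -> ideal_mem (x + y);
  idealMl : forall a x, ideal_mem x -> ideal_mem (a * x);
  idealMr : forall a x, ideal_mem x -> ideal_mem (x * a)
}.

Definition ideal_pred (I : ideal) : {pred A} := fun x => `[< I x >].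

Fact ideal_zmod_closed I : zmod_closed (ideal_pred I).
Proof.
split=> [|x y]; rewrite /in_mem /= /ideal_pred.
  by apply/asboolP; exact: ideal0.
move=> /asboolP Ix /asboolP Iy; apply/asboolP; apply: idealD => //.
by rewrite -mulN1r; exact: idealMl.
Qed.
HB.instance Definition _ I :=
  GRing.isZmodClosed.Build A (ideal_pred I) (ideal_zmod_closed I).

Definition quot_type (I : ideal) : Type := @Quotient.quot A (ideal_pred I).

HB.instance Definition _ I := GRing.Zmodule.on (quot_type I).
HB.instance Definition _ I := EqQuotient.on (quot_type I).

Definition quot_map (I : ideal) (x : A) : quot_type I := \pi_(quot_type I) x.

Definition quot_one I := quot_map I 1.
Definition quot_mul I (x y : quot_type I) := quot_map I (repr x * repr y).

Lemma quot_mapE I x y : (quot_map I x = quot_map I y) <-> I (x - y).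
Proof.
split; first by move/eqmodP => /= /asboolP.
by move=> Ixy; apply/eqmodP; apply/asboolP.
Qed.

Lemma quot_mapP I (x : quot_type I) : exists y, x = quot_map I y.
Proof. by exists (repr x); rewrite /quot_map reprK. Qed.

Fact quot_map_zmod I : zmod_morphism (quot_map I).
Proof. by move=> x y; rewrite /quot_map !piE. Qed.
HB.instance Definition _ I :=
  GRing.isZmodMorphism.Build A (quot_type I) (quot_map I) (quot_map_zmod I).

Fact quot_mapM I x y : quot_mul (quot_map I x) (quot_map I y) = quot_map I (x * y).
Proof.
apply/quot_mapE; set x' := repr _; set y' := repr _.
have Ix : I (x' - x) by apply/quot_mapE; rewrite /quot_map reprK.
have Iy : I (y' - y) by apply/quot_mapE; rewrite /quot_map reprK.
have -> : x' * y' - x * y = (x' - x) * y' + x * (y' - y).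
  by rewrite mulrBl mulrBr addrA subrK.
by apply: idealD; [exact: idealMr | exact: idealMl].
Qed.

Fact quot_mulA I : associative (@quot_mul I).
Proof.
move=> x y z; have [x0 ->] := quot_mapP x; have [y0 ->] := quot_mapP y.
by have [z0 ->] := quot_mapP z; rewrite !quot_mapM mulrA.
Qed.
Fact quot_mul1 I : left_id (quot_one I) (@quot_mul I).
Proof. by move=> x; have [x0 ->] := quot_mapP x; rewrite quot_mapM mul1r. Qed.
Fact quot_mulr1 I : right_id (quot_one I) (@quot_mul I).
Proof. by move=> x; have [x0 ->] := quot_mapP x; rewrite quot_mapM mulr1. Qed.
Fact quot_mulDl I : left_distributive (@quot_mul I) +%R.
Proof.
move=> x y z; have [x0 ->] := quot_mapP x; have [y0 ->] := quot_mapP y.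
have [z0 ->] := quot_mapP z.
by rewrite -raddfD !quot_mapM mulrDl raddfD.
Qed.
Fact quot_mulDr I : right_distributive (@quot_mul I) +%R.
Proof.
move=> x y z; have [x0 ->] := quot_mapP x; have [y0 ->] := quot_mapP y.
have [z0 ->] := quot_mapP z.
by rewrite -raddfD !quot_mapM mulrDr raddfD.
Qed.

HB.instance Definition _ I :=
  GRing.Zmodule_isPzRing.Build (quot_type I) (@quot_mulA I) (@quot_mul1 I)
    (@quot_mulr1 I) (@quot_mulDl I) (@quot_mulDr I).

Fact quot_map_monoid I : monoid_morphism (quot_map I).
Proof. by split=> // x y; rewrite -quot_mapM. Qed.
HB.instance Definition _ I :=
  GRing.isMonoidMorphism.Build A (quot_type I) (quot_map I) (quot_map_monoid I).

(* A e A, whose elements are finite sums of products a e b. *)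
Definition gen_mem (e : A) (x : A) : Prop :=
  exists s : seq (A * A), x = \sum_(p <- s) p.1 * e * p.2.

Fact gen_mem0 e : gen_mem e 0. Proof. by exists [::]; rewrite big_nil. Qed.
Fact gen_memD e x y : gen_mem e x -> gen_mem e y -> gen_mem e (x + y).
Proof. by move=> [s ->] [t ->]; exists (s ++ t); rewrite big_cat. Qed.
Fact gen_memMl e a x : gen_mem e x -> gen_mem e (a * x).
Proof.
move=> [s ->]; exists [seq (a * p.1, p.2) | p <- s].
by rewrite big_map mulr_sumr; apply: eq_bigr => p _; rewrite /= !mulrA.
Qed.
Fact gen_memMr e a x : gen_mem e x -> gen_mem e (x * a).
Proof.
move=> [s ->]; exists [seq (p.1, p.2 * a) | p <- s].
by rewrite big_map mulr_suml; apply: eq_bigr => p _; rewrite /= !mulrA.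
Qed.

Definition gen_ideal (e : A) : ideal :=
  Ideal (gen_mem0 e) (@gen_memD e) (@gen_memMl e) (@gen_memMr e).

Fact zero_idealD (x y : A) : x = 0 -> y = 0 -> x + y = 0.
Proof. by move=> -> ->; rewrite addr0. Qed.
Fact zero_idealMl (a x : A) : x = 0 -> a * x = 0.
Proof. by move=> ->; rewrite mulr0. Qed.
Fact zero_idealMr (a x : A) : x = 0 -> x * a = 0.
Proof. by move=> ->; rewrite mul0r. Qed.

Definition zero_ideal : ideal :=
  @Ideal (fun x => x = 0) erefl zero_idealD zero_idealMl zero_idealMr.

Section Radical.
Hypothesis mulC : commutative ( *%R : A -> A -> A).
Variable I : ideal.

Definition rad_mem (x : A) : Prop := exists n : nat, I (x ^+ n).

Fact rad_mem0 : rad_mem 0.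
Proof. by exists 1%N; rewrite expr1; exact: ideal0. Qed.
Fact rad_memD x y : rad_mem x -> rad_mem y -> rad_mem (x + y).
Proof.
move=> [m Ix] [n Iy]; exists (m + n)%N; rewrite (exprDn_comm _ (mulC x y)).
apply: (big_ind I) => [||i _]; [exact: ideal0 | exact: idealD |].
rewrite -mulr_natr; apply: idealMr.
have [lt_in | le_ni] := ltnP i n.
  by rewrite -addnBA 1?ltnW // exprD -mulrA; exact: idealMr.
by rewrite -(subnK le_ni) exprD mulrA; exact: idealMl.
Qed.
Fact rad_memMl a x : rad_mem x -> rad_mem (a * x).
Proof.
move=> [n Ix]; exists n; rewrite exprMn_comm; last exact: mulC.
exact: idealMl.
Qed.
Fact rad_memMr a x : rad_mem x -> rad_mem (x * a).
Proof. by move=> rx; rewrite mulC; exact: rad_memMl. Qed.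

Definition radical : ideal := Ideal rad_mem0 rad_memD rad_memMl rad_memMr.

End Radical.

Definition nilradical (mulC : commutative ( *%R : A -> A -> A)) : ideal :=
  radical mulC zero_ideal.

End Ideals.

Section QuotientAlgebra.
Variables (k : comPzRingType) (A : pz_algebra k) (I : ideal A).

Definition quot_alg_map : {rmorphism k -> quot_type I} :=
  quot_map I \o alg_map A.

Fact quot_alg_mapC a x : quot_alg_map a * x = x * quot_alg_map a.
Proof.
by have [y ->] := quot_mapP x; rewrite /= -!rmorphM /= alg_mapC.
Qed.

Definition quot_alg : pz_algebra k := @PzAlgebra k (quot_type I) _ quot_alg_mapC.

End QuotientAlgebra.

Section ContractSubalgebra.
Variables (k : comPzRingType) (A : pz_algebra k) (B : subalgebra A).
Variable I : ideal A.

Definition contract_mem (x : subalg B) : Prop := I (val x).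

Fact contract_mem0 : contract_mem 0. Proof. exact: ideal0. Qed.
Fact contract_memD x y :
  contract_mem x -> contract_mem y -> contract_mem (x + y).
Proof. exact: idealD. Qed.
Fact contract_memMl a x : contract_mem x -> contract_mem (a * x).
Proof. exact: idealMl. Qed.
Fact contract_memMr a x : contract_mem x -> contract_mem (x * a).
Proof. exact: idealMr. Qed.

(* B \cap I as an ideal of B. *)
Definition contract : ideal (subalg B) :=
  Ideal contract_mem0 contract_memD contract_memMl contract_memMr.

End ContractSubalgebra.

Section EndomorphismRing.
Variables (k : comNzRingType) (S : comAlgType k) (M : lmodType S).

Definition end_type : Type := {linear M -> M}.

HB.instance Definition _ := gen_eqMixin end_type.
HB.instance Definition _ := gen_choiceMixin end_type.

Definition end_fun (f : end_type) : M -> M := (f : {linear M -> M}).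
Local Coercion end_fun : end_type >-> Funclass.
Definition end_mk (f : {linear M -> M}) : end_type := f.

Lemma end_eqP (f g : end_type) : f =1 g <-> f = g.
Proof.
split=> [|->//]; case: f => f [[f0] [fZ]]; case: g => g [[g0] [gZ]].
rewrite /end_fun /= => fg.
have {}fg : f = g by exact: functional_extensionality_dep.
rewrite -{g}fg in g0 gZ *.
by rewrite (Prop_irrelevance f0 g0) (Prop_irrelevance fZ gZ).
Qed.

Definition end_zero : end_type := end_mk (GRing.null_fun M).
Definition end_add (f g : end_type) : end_type :=
  end_mk (GRing.add_fun (f : {linear M -> M}) (g : {linear M -> M})).
Definition end_opp (f : end_type) : end_type :=
  end_mk (GRing.opp_fun (f : {linear M -> M})).
Definition end_one : end_type := end_mk idfun.
Definition end_mul (f g : end_type) : end_type :=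
  end_mk ((f : {linear M -> M}) \o (g : {linear M -> M})).

Fact end_addA : associative end_add.
Proof. by move=> f g h; apply/end_eqP => x; exact: addrA. Qed.
Fact end_addC : commutative end_add.
Proof. by move=> f g; apply/end_eqP => x; exact: addrC. Qed.
Fact end_add0 : left_id end_zero end_add.
Proof. by move=> f; apply/end_eqP => x; exact: add0r. Qed.
Fact end_addN : left_inverse end_zero end_opp end_add.
Proof. by move=> f; apply/end_eqP => x; exact: addNr. Qed.
HB.instance Definition _ :=
  GRing.isZmodule.Build end_type end_addA end_addC end_add0 end_addN.

Fact end_mulA : associative end_mul.
Proof. by move=> f g h; apply/end_eqP. Qed.
Fact end_mul1 : left_id end_one end_mul.
Proof. by move=> f; apply/end_eqP. Qed.
Fact end_mulr1 : right_id end_one end_mul.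
Proof. by move=> f; apply/end_eqP. Qed.
Fact end_mulDl : left_distributive end_mul +%R.
Proof. by move=> f g h; apply/end_eqP. Qed.
Fact end_mulDr : right_distributive end_mul +%R.
Proof. by move=> f g h; apply/end_eqP => x; exact: linearD. Qed.
HB.instance Definition _ :=
  GRing.Zmodule_isPzRing.Build end_type
    end_mulA end_mul1 end_mulr1 end_mulDl end_mulDr.

Fact scale_linear (s : S) : linear (fun x : M => s *: x).
Proof. by move=> t x y; rewrite scalerDr !scalerA mulrC. Qed.

Definition end_scale (s : S) : end_type :=
  end_mk (HB.pack (fun x : M => s *: x)
            (GRing.isLinear.Build S M M *:%R _ (scale_linear s))).

Fact end_scale_zmod : zmod_morphism end_scale.
Proof. by move=> s t; apply/end_eqP => x; exact: scalerBl. Qed.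
Fact end_scale_monoid : monoid_morphism end_scale.
Proof.
by split=> [|s t]; apply/end_eqP => x; [exact: scale1r | exact/esym/scalerA].
Qed.
HB.instance Definition _ :=
  GRing.isZmodMorphism.Build S end_type end_scale end_scale_zmod.
HB.instance Definition _ :=
  GRing.isMonoidMorphism.Build S end_type end_scale end_scale_monoid.

Fact end_scaleC (s : S) (f : end_type) : end_scale s * f = f * end_scale s.
Proof. by apply/end_eqP => x; exact/esym/linearZ. Qed.

Definition end_alg_map : {rmorphism k -> end_type} := end_scale \o in_alg S.

Fact end_alg_mapC a (f : end_type) : end_alg_map a * f = f * end_alg_map a.
Proof. exact: end_scaleC. Qed.

Definition end_alg : pz_algebra k := @PzAlgebra k end_type end_alg_map end_alg_mapC.

Definition scalar_mem (f : end_alg) : Prop := exists s : S, f = end_scale s.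

Fact scalar_memK a : scalar_mem (alg_map end_alg a).
Proof. by exists (in_alg S a). Qed.
Fact scalar_memB f g : scalar_mem f -> scalar_mem g -> scalar_mem (f - g).
Proof. by move=> [s ->] [t ->]; exists (s - t); rewrite rmorphB. Qed.
Fact scalar_memM f g : scalar_mem f -> scalar_mem g -> scalar_mem (f * g).
Proof. by move=> [s ->] [t ->]; exists (s * t); rewrite rmorphM. Qed.

Definition scalar_subalg : subalgebra end_alg :=
  Subalgebra scalar_memK scalar_memB scalar_memM.

Fact scalar_mulC : commutative ( *%R : subalg scalar_subalg -> _ -> _).
Proof.
move=> f g; apply: val_inj; rewrite !rmorphM.
by case: f => f /= /asboolP [s ->]; exact: end_scaleC.
Qed.

End EndomorphismRing.

Section DirectSum.
Variables (S : pzRingType) (I : choiceType) (M : I -> lmodType S).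

Definition finitely_supported (m : forall i, M i) : Prop :=
  exists s : seq I, forall i, i \notin s -> m i = 0.

Record dirsum := DirSum {
  dirsum_val :> forall i, M i;
  dirsumP : finitely_supported dirsum_val
}.

HB.instance Definition _ := gen_eqMixin dirsum.
HB.instance Definition _ := gen_choiceMixin dirsum.

Lemma dirsum_eqP (m n : dirsum) : (forall i, m i = n i) <-> m = n.
Proof.
split=> [|->//]; case: m => m mP; case: n => n nP /= mn.
have {}mn : m = n by exact: functional_extensionality_dep.
by rewrite -{n}mn in nP *; rewrite (Prop_irrelevance mP nP).
Qed.

Fact dirsum_zeroP : finitely_supported (fun i => 0 : M i).
Proof. by exists [::]. Qed.
Fact dirsum_addP (m n : dirsum) : finitely_supported (fun i => m i + n i).
Proof.
have [[s ms] [t nt]] := (dirsumP m, dirsumP n); exists (s ++ t) => i.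
by rewrite mem_cat negb_or => /andP [/ms -> /nt ->]; rewrite addr0.
Qed.
Fact dirsum_oppP (m : dirsum) : finitely_supported (fun i => - m i).
Proof. by have [s ms] := dirsumP m; exists s => i /ms ->; rewrite oppr0. Qed.
Fact dirsum_scaleP (a : S) (m : dirsum) : finitely_supported (fun i => a *: m i).
Proof. by have [s ms] := dirsumP m; exists s => i /ms ->; rewrite scaler0. Qed.

Definition dirsum_zero := DirSum dirsum_zeroP.
Definition dirsum_add m n := DirSum (dirsum_addP m n).
Definition dirsum_opp m := DirSum (dirsum_oppP m).
Definition dirsum_scale a m := DirSum (dirsum_scaleP a m).

Fact dirsum_addA : associative dirsum_add.
Proof. by move=> m n p; apply/dirsum_eqP => i; exact: addrA. Qed.
Fact dirsum_addC : commutative dirsum_add.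
Proof. by move=> m n; apply/dirsum_eqP => i; exact: addrC. Qed.
Fact dirsum_add0 : left_id dirsum_zero dirsum_add.
Proof. by move=> m; apply/dirsum_eqP => i; exact: add0r. Qed.
Fact dirsum_addN : left_inverse dirsum_zero dirsum_opp dirsum_add.
Proof. by move=> m; apply/dirsum_eqP => i; exact: addNr. Qed.
HB.instance Definition _ :=
  GRing.isZmodule.Build dirsum dirsum_addA dirsum_addC dirsum_add0 dirsum_addN.

Fact dirsum_scaleA a b m :
  dirsum_scale a (dirsum_scale b m) = dirsum_scale (a * b) m.
Proof. by apply/dirsum_eqP => i; exact: scalerA. Qed.
Fact dirsum_scale1 : left_id 1 dirsum_scale.
Proof. by move=> m; apply/dirsum_eqP => i; exact: scale1r. Qed.
Fact dirsum_scaleDr : right_distributive dirsum_scale +%R.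
Proof. by move=> a m n; apply/dirsum_eqP => i; exact: scalerDr. Qed.
Fact dirsum_scaleDl m : {morph dirsum_scale^~ m : a b / a + b}.
Proof. by move=> a b; apply/dirsum_eqP => i; exact: scalerDl. Qed.
HB.instance Definition _ :=
  GRing.Zmodule_isLmodule.Build S dirsum
    dirsum_scaleA dirsum_scale1 dirsum_scaleDr dirsum_scaleDl.

Fact summand_projP (i0 : I) (m : dirsum) :
  finitely_supported (fun i => if i == i0 then m i else 0).
Proof. by exists [:: i0] => i; rewrite inE => /negbTE ->. Qed.

Definition summand_proj (i0 : I) (m : dirsum) : dirsum :=
  DirSum (summand_projP i0 m).

Fact summand_proj_linear i0 : linear (summand_proj i0).
Proof.
move=> a m n; apply/dirsum_eqP => i /=.
by case: (i == i0) => //=; rewrite scaler0 addr0.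
Qed.
HB.instance Definition _ i0 :=
  GRing.isLinear.Build S dirsum dirsum *:%R (summand_proj i0)
    (summand_proj_linear i0).

End DirectSum.

Section LinearGroups.
Variables (k : fieldType) (V : vectType k).

Definition lfun_det (g : 'End(V)) : k :=
  \det (\matrix_(i, j < \dim {:V})
          coord (vbasis {:V}) i (g (vbasis {:V})`_j)).

Definition is_subgroup_SL (G : {fset 'End(V)}) : Prop :=
  [/\ {in G, forall g, lfun_det g = 1},
      (\1%VF \in G),
      {in G &, forall g h, (g \o h)%VF \in G}
    & {in G, forall g, (g^-1)%VF \in G}].

Definition is_abelian (G : {fset 'End(V)}) : Prop :=
  {in G &, forall g h, (g \o h)%VF = (h \o g)%VF}.

(* k[V]; the variable 'X_i is the i-th coordinate function with respect to
   vbasis {:V}. *)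
Definition coord_ring := {mpoly k[\dim {:V}]}.

Definition coord_eval (f : coord_ring) (v : V) : k :=
  f.@[fun i => coord (vbasis {:V}) i v].

Definition coord_subst (g : 'End(V)) : (\dim {:V}).-tuple coord_ring :=
  [tuple \sum_(j < \dim {:V})
     coord (vbasis {:V}) i ((g^-1)%VF (vbasis {:V})`_j) *: 'X_j
   | i < \dim {:V}].

Definition act (g : 'End(V)) (f : coord_ring) : coord_ring :=
  f \mPo coord_subst g.

Lemma actE g f v : coord_eval (act g f) v = coord_eval f ((g^-1)%VF v).
Proof.
rewrite /coord_eval /act comp_mpoly_meval; apply: meval_eq => i.
rewrite tnth_mktuple raddf_sum /= [in RHS](coord_vbasis (memvf v)).
rewrite !linear_sum /=; apply: eq_bigr => j _.
by rewrite mevalZ mevalXU !linearZ /= mulrC.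
Qed.

End LinearGroups.

Section SemiInvariants.
Variables (k : fieldType) (V : vectType k) (G : {fset 'End(V)}).
Local Notation R := (coord_ring V).

(* Characters G -> k^*. The carrier of G has no group structure of its own, so
   multiplicativity quantifies over an element gh of G equal to g \o h. *)
Definition is_character (chi : {ffun G -> k}) : bool :=
  [forall g : G, chi g != 0] &&
  [forall g : G, forall h : G, forall gh : G,
     (fsval gh == (fsval g \o fsval h)%VF) ==> (chi gh == chi g * chi h)].

Record character := Character {
  char_val :> {ffun G -> k};
  _ : is_character char_val
}.
HB.instance Definition _ := [isSub for char_val].
HB.instance Definition _ := [Choice of character by <:].

Fact trivial_charP : is_character [ffun=> 1].
Proof.
apply/andP; split; apply/forallP => g; first by rewrite ffunE oner_neq0.
by apply/forallP => h; apply/forallP => p; rewrite !ffunE mulr1 eqxx implybT.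
Qed.
Definition trivial_char : character := Character trivial_charP.

(* S = R^G *)
Definition invariant : {pred R} :=
  fun f => [forall g : G, act (fsval g) f == f].

Record invariants := Invariant {
  inv_val : R;
  _ : invariant inv_val
}.
HB.instance Definition _ := [isSub for inv_val].
HB.instance Definition _ := [Choice of invariants by <:].

Lemma invariantP f :
  reflect (forall g : G, act (fsval g) f = f) (f \in invariant).
Proof. exact: 'forall_eqP. Qed.

Fact invariant_closed : GRing.subalg_closed invariant.
Proof.
split=> [|a f h /invariantP Hf /invariantP Hh|f h /invariantP Hf /invariantP Hh];
  apply/invariantP => g; rewrite /act.
- exact: rmorph1.
- by rewrite linearP /= -!/(act _ _) Hf Hh.
- by rewrite rmorphM /= -!/(act _ _) Hf Hh.
Qed.
HB.instance Definition _ :=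
  GRing.SubChoice_isSubAlgebra.Build k R invariant invariants
    (GRing.subalg_closed_semi invariant_closed).
HB.instance Definition _ :=
  GRing.SubNzRing_isSubComNzRing.Build R invariant invariants.

Variable chi : character.

(* M_chi, as the S-module of f in R with g.f = chi(g)^-1 f for all g in G *)
Definition semi_invariant : {pred R} :=
  fun f => [forall g : G, act (fsval g) f == (chi g)^-1 *: f].

Record semi_invariants := SemiInvariant {
  sinv_val : R;
  _ : semi_invariant sinv_val
}.
HB.instance Definition _ := [isSub for sinv_val].
HB.instance Definition _ := [Choice of semi_invariants by <:].

Lemma semi_invariantP f :
  reflect (forall g : G, act (fsval g) f = (chi g)^-1 *: f)
          (f \in semi_invariant).
Proof. exact: 'forall_eqP. Qed.

Fact semi_invariant_closed : zmod_closed semi_invariant.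
Proof.
split=> [|f h /semi_invariantP Hf /semi_invariantP Hh];
  apply/semi_invariantP => g; rewrite /act; first by rewrite raddf0 scaler0.
by rewrite raddfB /= -!/(act _ _) Hf Hh scalerBr.
Qed.
HB.instance Definition _ :=
  GRing.SubChoice_isSubZmodule.Build R semi_invariant semi_invariants
    semi_invariant_closed.

Fact semi_invariant_scaleP (s : invariants) (f : semi_invariants) :
  semi_invariant (val s * val f).
Proof.
case: s f => s /invariantP Hs [f /semi_invariantP Hf] /=.
apply/semi_invariantP => g.
by rewrite /act rmorphM /= -!/(act _ _) Hs Hf scalerAr.
Qed.
Definition semi_invariant_scale s f : semi_invariants :=
  SemiInvariant (semi_invariant_scaleP s f).

Fact semi_invariant_scaleA a b f :
  semi_invariant_scale a (semi_invariant_scale b f) =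
  semi_invariant_scale (a * b) f.
Proof. by apply: val_inj; exact: mulrA. Qed.
Fact semi_invariant_scale1 : left_id 1 semi_invariant_scale.
Proof. by move=> f; apply: val_inj; exact: mul1r. Qed.
Fact semi_invariant_scaleDr : right_distributive semi_invariant_scale +%R.
Proof. by move=> s f h; apply: val_inj; exact: mulrDr. Qed.
Fact semi_invariant_scaleDl f : {morph semi_invariant_scale^~ f : a b / a + b}.
Proof. by move=> a b; apply: val_inj; exact: mulrDl. Qed.
HB.instance Definition _ :=
  GRing.Zmodule_isLmodule.Build invariants semi_invariants
    semi_invariant_scaleA semi_invariant_scale1
    semi_invariant_scaleDr semi_invariant_scaleDl.

End SemiInvariants.

Section ContractionAlgebra.
Variables (k : fieldType) (V : vectType k) (G : {fset 'End(V)}).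
Local Notation S := (invariants G).

(* M^, the direct sum of all the M_chi *)
Definition Mhat : lmodType S := dirsum (fun chi : character G => semi_invariants chi).

Definition Lambda : pz_algebra k := end_alg Mhat.

Definition Lambda_e : Lambda := end_mk (summand_proj (trivial_char G)).

Definition phi : {rmorphism S -> Lambda} := @end_scale k S Mhat.

Definition phi_S : subalgebra Lambda := scalar_subalg Mhat.

Definition LeL : ideal Lambda := gen_ideal Lambda_e.

Definition Lambda_con : pz_algebra k := quot_alg LeL.

(* R^{M^} = Z(Lambda_con) / nil(Z(Lambda_con)) *)
Definition center_red : pz_algebra k :=
  quot_alg (nilradical (@center_mulC k Lambda_con)).

(* phi(S) / sqrt(phi(S) \cap Lambda e Lambda) *)
Definition phi_S_red : pz_algebra k :=
  quot_alg (radical (@scalar_mulC k S Mhat) (contract phi_S LeL)).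

Fact phi_mem (s : S) : phi_S (phi s). Proof. by exists s. Qed.

Fact phi_con_center (s : S) : center Lambda_con (quot_map LeL (phi s)).
Proof.
by move=> x; have [y ->] := quot_mapP x; rewrite -!rmorphM /= end_scaleC.
Qed.

Definition phi_S_red_of (s : S) : phi_S_red :=
  quot_map _ (subalg_elt (phi_mem s)).

(* The composite S -> Lambda -> Lambda_con, corestricted to the center and
   reduced. *)
Definition center_red_of (s : S) : center_red :=
  quot_map _ (subalg_elt (phi_con_center s)).

End ContractionAlgebra.

(* Main.v *)
(* After diagonalising G, every M_chi is spanned by monomials.  As G lies in SL,
   the product of the variables is invariant, which makes G small, so that an
   S-linear map M_chi -> M_psi is multiplication by a polynomial; it lies in
   Lambda e Lambda exactly when this polynomial lies in M_(chi^-1) M_psi.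
   Modulo Lambda e Lambda, a central element z thus acts on M_chi as
   multiplication by some r_chi in S.  An invariant monomial m has a power in
   M_(chi^-1) M_chi exactly when chi is in the group W_m generated by the
   characters of the variables dividing m.  Since z commutes with
   multiplication by each variable, the coefficient of m in r_chi is unchanged
   when chi is multiplied by the character of a variable without meeting W_m,
   hence is the same for all chi outside W_m.  These common coefficients define
   s in S such that z - s is nilpotent modulo Lambda e Lambda. *)
Require Import Defs.
From HB Require Import structures.
From mathcomp Require Import all_boot all_order all_algebra.
From mathcomp Require Import finmap.
From mathcomp Require Import mpoly boolp separable cyclotomic.

Set Implicit Arguments.
Unset Strict Implicit.
Unset Printing Implicit Defensive.

Import GRing.Theory.
Local Open Scope ring_scope.

(** * Characters of monomials *)

Section Supports.
Variable n : nat.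
Implicit Types a b m : 'X_{1..n}.

Definition supp_sub a m := [forall i, (m i == 0%N) ==> (a i == 0%N)].

Lemma supp_subP a m :
  reflect (forall i, m i = 0%N -> a i = 0%N) (supp_sub a m).
Proof.
apply: (iffP forallP) => [h i mi0|h i].
  by apply/eqP/(implyP (h i))/eqP.
by apply/implyP => /eqP /h ->.
Qed.

Lemma supp_sub0 m : supp_sub 0%MM m.
Proof. by apply/supp_subP => i _; rewrite mnm0E. Qed.

Lemma supp_subD a b m : supp_sub a m -> supp_sub b m -> supp_sub (a + b)%MM m.
Proof.
move=> /supp_subP am /supp_subP bm; apply/supp_subP => i mi0.
by rewrite mnmDE am // bm.
Qed.

Lemma supp_subMn a m j : supp_sub a m -> supp_sub (a *+ j)%MM m.
Proof.
move=> /supp_subP am; apply/supp_subP => i mi0.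
by rewrite mulmnE am // mul0n.
Qed.

Lemma lem_supp_sub a m : (a <= m)%MM -> supp_sub a m.
Proof.
move=> /mnm_lepP am; apply/supp_subP => i mi0.
by move: (am i); rewrite mi0 leqn0 => /eqP.
Qed.

(** Every exponent of [a] is at most [mdeg a], and [m] has exponent at least one wherever [a] does,
    so j = [mdeg a] works. *)
Lemma supp_sub_lem a m : supp_sub a m -> exists j, (a <= m *+ j)%MM.
Proof.
move=> /supp_subP am; exists (mdeg a); apply/mnm_lepP => i; rewrite mulmnE.
have [/am -> //|mi] := eqVneq (m i) 0%N.
apply: (@leq_trans (mdeg a)); first by rewrite mdegE (bigD1 i) //= leq_addr.
by rewrite leq_pmull // lt0n.
Qed.

Lemma mnm_neq0 a : a != 0%MM -> exists i, exists a', a = (a' + U_(i))%MM.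
Proof.
move=> a0; have [i ai] : exists i, a i != 0%N.
  apply/existsP; apply: contraNT a0; rewrite negb_exists => /forallP a0.
  by apply/eqP/mnmP => i; rewrite mnm0E; apply/eqP; move: (a0 i); rewrite negbK.
by exists i, (a - U_(i))%MM; rewrite submK // lep1mP.
Qed.

End Supports.

Section Grading.
Variables (n : nat) (C : eqType) (chr : 'X_{1..n} -> C) (N : nat).
Implicit Types a b m : 'X_{1..n}.
(** [C] carries no group law: [chrD] makes equality of [chr] a congruence, and [chrN] makes the
    quotient monoid a group of exponent dividing [N.+1], in which [a *+ N] represents the inverse of
    [a]. *)
Hypothesis chrD : forall a a' b b',
  chr a = chr a' -> chr b = chr b' -> chr (a + b)%MM = chr (a' + b')%MM.
Hypothesis chrN : forall a, chr (a *+ N.+1)%MM = chr 0%MM.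

(** Adding [c *+ N] to both sides completes [c] to [c *+ N.+1], which is trivial. *)
Lemma chr_addI a b c : chr (c + a)%MM = chr (c + b)%MM -> chr a = chr b.
Proof.
move=> /(chrD (erefl (chr (c *+ N)%MM))).
rewrite !addmA -mulmSr => h.
have e d : chr (c *+ N.+1 + d)%MM = chr d.
  by rewrite -{2}(add0m d); apply: chrD; rewrite ?chrN.
by move: h; rewrite !e.
Qed.

Lemma chrMn a b j : chr a = chr b -> chr (a *+ j)%MM = chr (b *+ j)%MM.
Proof.
move=> ab; elim: j => [|j IH]; first by rewrite !mulm0n.
by rewrite !mulmS; apply: chrD.
Qed.

(* [chr a] lies in the group W_m generated by the characters of the variables
   dividing m; being finite, this group is the monoid they generate. *)
Definition inW m a := exists2 b, supp_sub b m & chr b = chr a.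

Lemma inW_chr m a a' : chr a = chr a' -> inW m a -> inW m a'.
Proof. by move=> aa [b bm ba]; exists b; rewrite ?ba. Qed.

Lemma inWD m a b : inW m a -> inW m b -> inW m (a + b)%MM.
Proof.
move=> [a' am' aa] [b' bm' bb]; exists (a' + b')%MM; first exact: supp_subD.
exact: chrD.
Qed.

Lemma inWMn m a j : inW m a -> inW m (a *+ j)%MM.
Proof.
by move=> [b bm ba]; exists (b *+ j)%MM; [exact: supp_subMn|exact: chrMn].
Qed.

(** The inverse [b *+ N] lies in W_m along with [b] and cancels it. *)
Lemma inWDr m a b : inW m b -> inW m (a + b)%MM -> inW m a.
Proof.
move=> Wb Wab; have := inWD Wab (inWMn N Wb); apply: inW_chr.
by rewrite -addmA -mulmS -[in RHS](addm0 a); apply: chrD; rewrite ?chrN.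
Qed.

Lemma inW_inv m a b : chr (a + b)%MM = chr 0%MM -> inW m b -> inW m a.
Proof.
move=> ab0 Wb; apply: (inWDr Wb); apply: (inW_chr (esym ab0)).
by exists 0%MM => //; exact: supp_sub0.
Qed.

(* In the Cayley graph of the quotient by W_m, with the variables as generators,
   the complement of the identity is connected: a shortest word for a vertex
   leads from one of its letters to it without meeting the identity; two
   letters g, h are joined through g + h, or, when h = - g, through the
   multiples of g. *)
Section Connectedness.
Variables (m : 'X_{1..n}) (T : Type) (c : 'X_{1..n} -> T).
Hypothesis c_chr : forall a b, chr a = chr b -> c a = c b.
Hypothesis c_step : forall a i,
  ~ inW m a -> ~ inW m (a + U_(i))%MM -> c a = c (a + U_(i))%MM.

(** Adding variables that divide m stays in one coset of W_m, so the walk from [a] never enters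
    W_m. *)
Lemma c_shift a b : supp_sub b m -> ~ inW m a -> c a = c (a + b)%MM.
Proof.
have [j] := ubnP (mdeg b); elim: j b => // j IH b bj bm Wa.
have [->|/mnm_neq0 [i [b' bE]]] := eqVneq b 0%MM; first by rewrite addm0.
have b'm : supp_sub b' m.
  apply/supp_subP => l ml; move/supp_subP: bm => /(_ l ml).
  by rewrite bE mnmDE => /eqP; rewrite addn_eq0 => /andP [/eqP].
have nW d : supp_sub d m -> ~ inW m (a + d)%MM.
  by move=> dm Wad; apply: Wa; apply: (inWDr _ Wad); exists d.

rewrite (IH b') //; last by move: bj; rewrite bE mdegD mdeg1 addn1 ltnS.
by rewrite bE addmA; apply: c_step; rewrite -?addmA -?bE; exact: nW.
Qed.

(** Write [a] as a' plus a letter: if a' is in W_m, then [a] and that letter share a coset;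
    otherwise recurse on a'. The clause on [a i] lets [c_vars] identify the letter when [a] is a
    multiple of one variable. *)
Lemma c_var a : ~ inW m a ->
  exists i, [/\ a i != 0%N, ~ inW m U_(i)%MM & c a = c U_(i)%MM].
Proof.
have [j] := ubnP (mdeg a); elim: j a => // j IH a aj Wa.
have [a0|/mnm_neq0 [i [a' aE]]] := eqVneq a 0%MM.
  by case: Wa; exists 0%MM; rewrite ?a0 // supp_sub0.
have [[b bm ba]|Wa'] := pselect (inW m a').
  have WU : ~ inW m U_(i)%MM.
    by move=> WU; apply: Wa; rewrite aE; apply: inWD => //; exists b.
  exists i; split => //; first by rewrite aE mnmDE mnm1E eqxx addn1.
  rewrite (c_shift bm WU); apply: c_chr; rewrite aE addmC.
  by apply: chrD.
have [|l [al Wl ca']] := IH a' _ Wa'.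
  by move: aj; rewrite aE mdegD mdeg1 addn1 ltnS.
exists l; split => //; last by rewrite -ca' aE -c_step // -aE.
by rewrite aE mnmDE addn_eq0 negb_and al.
Qed.

Lemma c_vars i j : ~ inW m U_(i)%MM -> ~ inW m U_(j)%MM ->
  c U_(i)%MM = c U_(j)%MM.
Proof.
move=> Wi Wj.
have [[b bm bij]|Wij] := pselect (inW m (U_(i) + U_(j))%MM); last first.
  by rewrite (c_step Wi Wij) addmC -c_step // addmC.
(* Now [U_(j)] is inverse to [U_(i)] modulo W_m, hence congruent to [U_(i) *+ N]. The only letter of
   the latter is i, so [c_var] must return i. *)
have jE : chr U_(j)%MM = chr (U_(i) *+ N + b)%MM.
  apply: (@chr_addI _ _ U_(i)%MM); rewrite addmA -mulmS -bij -{1}(add0m b).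
  by apply: chrD; rewrite ?chrN.
have WN : ~ inW m (U_(i) *+ N)%MM.
  move=> WN; apply: Wj; apply: (inW_chr (esym jE)).
  by apply: inWD => //; exists b.
rewrite (c_chr jE) -c_shift //; have [l [/eqP il _ ->]] := c_var WN.
case: (eqVneq i l) il => [-> //|/negbTE il].
by rewrite mulmnE mnm1E il.
Qed.

Lemma c_const a b : ~ inW m a -> ~ inW m b -> c a = c b.
Proof.
by move=> /c_var [i [_ Wi ->]] /c_var [j [_ Wj ->]]; exact: c_vars.
Qed.

End Connectedness.
End Grading.

(** * Matrices of the elements of G *)

Section Diagonalization.

(** The minimal polynomial divides X^(N+1) - 1, which splits over a closed field, with simple roots
    in characteristic zero. *)
Lemma diagonalizable_finite_order (k : closedFieldType) n (A : 'M[k]_n) N :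
  [pchar k] =i pred0 -> A ^+ N.+1 = 1 ->
  exists2 P, P \in unitmx & is_diag_mx (mxpoly.conjmx P A).
Proof.
move=> k0; case: n A => [|n] A AN.
  by rewrite [A]flatmx0; exact: mxpoly.diagonalizable0.
have [r rE] := closed_field_poly_normal ('X ^+ N.+1 - 1 : {poly k}).
have lc1 : lead_coef ('X ^+ N.+1 - 1 : {poly k}) = 1.
  by apply/eqP; have := monicXnsubC (1 : k) (ltn0Sn N); rewrite polyC1.
rewrite lc1 scale1r in rE.
apply/mxpoly.diagonalizableP; exists r.
  rewrite -separable_prod_XsubC -rE; apply: separable_Xn_sub_1.
  by have /pcharf0P -> := k0.
rewrite -rE; apply: mxminpoly_min.
by rewrite rmorphB rmorphXn rmorph1 /= horner_mx_X AN subrr.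
Qed.

Variables (k : fieldType) (V : vectType k).
Implicit Types g h : 'End(V).

(** The matrix whose determinant is [lfun_det g]. *)
Definition lfun_mx g : 'M[k]_(\dim {:V}) :=
  \matrix_(i, j) coord (vbasis {:V}) i (g (vbasis {:V})`_j).

Lemma lfun_mx1 : lfun_mx \1%VF = 1%:M.
Proof.
apply/matrixP => i j; rewrite !mxE id_lfunE.
by rewrite coord_free ?(basis_free (vbasisP _)) // eq_sym.
Qed.

Lemma lfun_mxM g h : lfun_mx (g \o h)%VF = lfun_mx g *m lfun_mx h.
Proof.
apply/matrixP => i j; rewrite !mxE comp_lfunE.
rewrite [X in g X](coord_vbasis (memvf _)) !linear_sum /=.
by apply: eq_bigr => l _; rewrite !linearZ /= !mxE mulrC.
Qed.

Lemma lfun_mx_coord g v i :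
  coord (vbasis {:V}) i (g v) =
  \sum_j lfun_mx g i j * coord (vbasis {:V}) j v.
Proof.
rewrite [X in g X](coord_vbasis (memvf v)) !linear_sum /=.
by apply: eq_bigr => j _; rewrite !linearZ /= mxE mulrC.
Qed.

Lemma lfun_mx_lker0 g : lfun_mx g \in unitmx -> lker g == 0%VS.
Proof.
move=> gU; rewrite -subv0; apply/subvP => v; rewrite memv_ker memv0 => /eqP gv.
have : lfun_mx g *m (\col_j coord (vbasis {:V}) j v) = 0.
  apply/matrixP => i j.
  have e0 : coord (vbasis {:V}) i (g v) = 0 by rewrite gv linear0.
  rewrite mxE [RHS]mxE -[RHS]e0 lfun_mx_coord.
  by apply: eq_bigr => l _; rewrite [X in _ * X]mxE.
move/(congr1 (mulmx (invmx (lfun_mx g)))); rewrite mulKmx // mulmx0 => v0.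
rewrite (coord_vbasis (memvf v)) big1 // => i _.
by move/matrixP/(_ i 0): v0; rewrite !mxE => ->; rewrite scale0r.
Qed.

Lemma lfun_mxV g : lfun_mx g \in unitmx ->
  lfun_mx g^-1%VF = invmx (lfun_mx g).
Proof.
move=> gU; rewrite -[LHS](mulKmx gU) -lfun_mxM.
by rewrite (lker0_compfV (lfun_mx_lker0 gU)) lfun_mx1 mulmx1.
Qed.

Variable G : {fset 'End(V)}.
Hypothesis slG : is_subgroup_SL G.

Lemma det_lfun_mx g : g \in G -> \det (lfun_mx g) = 1.
Proof. by case: slG => h _ _ _ /h. Qed.

Lemma lfun_mx_unit g : g \in G -> lfun_mx g \in unitmx.
Proof. by move=> gG; rewrite unitmxE det_lfun_mx // unitr1. Qed.

(** By pigeonhole two of the powers 0, ..., |G| of g agree, so g has order at most |G|; this order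
    divides |G|!, an exponent common to all g. *)
Lemma lfun_mx_order : exists N, forall g, g \in G -> lfun_mx g ^+ N.+1 = 1.
Proof.
exists ((#|{: G}|)`!).-1 => g gG; rewrite prednK ?fact_gt0 //.
have pG j : iter j (comp_lfun g) \1%VF \in G.
  case: slG => _ G1 GM _; elim: j => //= j IH; exact: GM.
have pE j : lfun_mx (iter j (comp_lfun g) \1%VF) = lfun_mx g ^+ j.
  elim: j => [|j IH] /=; first by rewrite lfun_mx1 expr0.
  by rewrite lfun_mxM IH exprS mulmxE.
pose f (j : 'I_#|{: G}|.+1) : G := [` pG j]%fset.
have /injectivePn [a [b ab fab]] : ~~ injectiveb f.
  by apply/negP => /injectiveP /leq_card; rewrite card_ord ltnn.
wlog ltab : a b ab fab / (a < b)%N.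
  move=> h; have [lt|lt|/val_inj e] := ltngtP a b; first exact: h ab fab lt.
    by apply: h lt => //; rewrite eq_sym.
  by rewrite e eqxx in ab.
have eab : lfun_mx g ^+ a = lfun_mx g ^+ b.
  by rewrite -!pE; congr lfun_mx; have := congr1 val fab.
have gU j : lfun_mx g ^+ j \in unitmx.
  by rewrite -pE; apply: lfun_mx_unit.
have e1 : lfun_mx g ^+ (b - a) = 1.
  rewrite -[LHS](mulKmx (gU a)) mulmxE -exprD subnKC ?(ltnW ltab) // -eab.
  by rewrite -mulmxE mulVmx.
have /dvdnP [q ->] : (b - a %| (#|{: G}|)`!)%N.
  rewrite dvdn_fact // subn_gt0 ltab leq_subLR.
  by rewrite (leq_trans _ (leq_addl _ _)) // -ltnS.
by rewrite mulnC exprM e1 expr1n.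
Qed.

End Diagonalization.

(** * Diagonalising the action *)

Section LinearSubstitution.
Variables (k : fieldType) (n : nat).
Implicit Types (A B : 'M[k]_n) (p : {mpoly k[n]}).

Definition lin_tuple A : n.-tuple {mpoly k[n]} :=
  [tuple \sum_j A i j *: 'X_j | i < n].

Lemma lin_tuple1 : lin_tuple 1%:M = [tuple 'X_i | i < n].
Proof.
apply/eq_from_tnth => i; rewrite !tnth_mktuple (bigD1 i) //= mxE eqxx scale1r.
by rewrite big1 ?addr0 // => j /negbTE ji; rewrite mxE eq_sym ji scale0r.
Qed.

Lemma comp_lin_tuple A B p :
  (p \mPo lin_tuple A) \mPo lin_tuple B = p \mPo lin_tuple (A *m B).
Proof.
rewrite !(comp_mpolyE p) raddf_sum; apply: eq_bigr => m _.
rewrite /= comp_mpolyZ rmorph_prod /=; congr (_ *: _).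
apply: eq_bigr => i _; rewrite rmorphXn /=; congr (_ ^+ _).
rewrite !tnth_mktuple raddf_sum /= (eq_bigr (fun j =>
  \sum_l (A i j * B j l) *: 'X_l)); last first.
  move=> j _; rewrite comp_mpolyZ comp_mpolyXU -tnth_nth tnth_mktuple.
  by rewrite scaler_sumr; apply: eq_bigr => l _; rewrite scalerA.
rewrite exchange_big /=; apply: eq_bigr => l _.
by rewrite mxE scaler_suml.
Qed.

Lemma comp_diag_mcoeff (d : 'rV[k]_n) p m :
  (p \mPo lin_tuple (diag_mx d))@_m = p@_m * \prod_i d 0 i ^+ m i.
Proof.
have dE i : tnth (lin_tuple (diag_mx d)) i = d 0 i *: 'X_i.
  rewrite tnth_mktuple (bigD1 i) //= mxE eqxx mulr1n big1 ?addr0 // => j.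
  by rewrite mxE eq_sym => /negbTE ->; rewrite mulr0n scale0r.
have XE (a : 'X_{1..n}) : \prod_i tnth (lin_tuple (diag_mx d)) i ^+ a i =
    (\prod_i d 0 i ^+ a i) *: 'X_[a].
  rewrite [in RHS]mpolyXE_id -scaler_prod.
  by apply: eq_bigr => i _; rewrite dE exprZn.
rewrite comp_mpolyE raddf_sum /=.
transitivity (\sum_(a <- msupp p) (p@_a * (\prod_i d 0 i ^+ a i)) * (a == m)%:R).
  by apply: eq_bigr => a _; rewrite XE scalerA mcoeffZ mcoeffX.
have [mp|mp] := boolP (m \in msupp p).
  rewrite (bigD1_seq m) ?msupp_uniq //= eqxx mulr1.
  rewrite [X in _ + X]big1 ?addr0 // => a /negbTE ->; exact: mulr0.
rewrite (memN_msupp_eq0 mp) mul0r big_seq; apply: big1 => a ap.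
by case: eqVneq ap mp => [->->|] //; rewrite mulr0.
Qed.

End LinearSubstitution.

(* [wg_chr m] is the character chi such that the m-th monomial in a basis of
   eigenvectors of G lies in M_chi; [wg_of] substitutes this basis for the
   variables, [wg_to] is its inverse. *)
Record weight_grading (k : fieldType) (V : vectType k) (G : {fset 'End(V)}) :=
  WeightGrading {
  wg_to : {lrmorphism coord_ring V -> coord_ring V};
  wg_of : {lrmorphism coord_ring V -> coord_ring V};
  wg_toK : cancel wg_to wg_of;
  wg_ofK : cancel wg_of wg_to;
  wg_chr : 'X_{1..\dim {:V}} -> character G;
  wg_exp : nat;
  wg_chrD : forall a a' b b', wg_chr a = wg_chr a' -> wg_chr b = wg_chr b' ->
    wg_chr (a + b)%MM = wg_chr (a' + b')%MM;
  wg_chr0 : wg_chr 0%MM = trivial_char G;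
  wg_chrN : forall a, wg_chr (a *+ wg_exp.+1)%MM = wg_chr 0%MM;
  wg_chr_prod : wg_chr (\sum_i U_(i))%MM = wg_chr 0%MM;
  wg_semi : forall chi f, f \in semi_invariant chi <->
    (forall m, m \in msupp (wg_to f) -> wg_chr m = chi)
}.

Section WeightGrading.

Lemma simultaneous_diagonalization (k : closedFieldType) (V : vectType k)
    (G : {fset 'End(V)}) :
  [pchar k] =i pred0 -> is_subgroup_SL G -> is_abelian G ->
  exists2 P, P \in unitmx & forall g, g \in G ->
    is_diag_mx (P *m lfun_mx g *m invmx P).
Proof.
move=> k0 slG abG; have [N GN] := lfun_mx_order slG.
have [+ _] := mxpoly.codiagonalizableP [seq lfun_mx g | g <- G].
case=> [|P PU /allP Pdiag].
  split=> [A B /mapP [g gG ->] /mapP [h hG ->]|A /mapP [g gG ->]].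
    by rewrite /comm_mx -!lfun_mxM abG.
  exact: (diagonalizable_finite_order k0 (GN g gG)).
exists P => // g gG; rewrite -mxpoly.conjumx //.
by apply: Pdiag; apply/mapP; exists g.
Qed.

Variables (k : fieldType) (V : vectType k) (G : {fset 'End(V)}).
Hypothesis slG : is_subgroup_SL G.
Variable P : 'M[k]_(\dim {:V}).
Hypothesis PU : P \in unitmx.

Definition conj_mx g := P *m lfun_mx g *m invmx P.

Hypothesis Pdiag : forall g, g \in G -> is_diag_mx (conj_mx g).

Lemma conj_mxM g h : conj_mx (g \o h)%VF = conj_mx g *m conj_mx h.
Proof.
by rewrite /conj_mx lfun_mxM -!mulmxA; congr (_ *m (_ *m _)); rewrite mulKmx.
Qed.

Lemma conj_mx_exp g N : lfun_mx g ^+ N = 1 -> conj_mx g ^+ N = 1.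
Proof.
move=> gN; have -> j : conj_mx g ^+ j = P *m (lfun_mx g ^+ j) *m invmx P.
  elim: j => [|j IH]; first by rewrite !expr0 mulmx1 mulmxV.
  rewrite !exprS IH -!mulmxE /conj_mx -!mulmxA; congr (_ *m (_ *m _)).
  by rewrite mulKmx.
by rewrite gN mulmx1 mulmxV.
Qed.

Definition eigen g i := conj_mx g i i.

Lemma conj_mxE g : g \in G -> conj_mx g = diag_mx (\row_i eigen g i).
Proof.
move=> gG; have /diag_mxP [d dE] := Pdiag gG; rewrite dE; congr diag_mx.
by apply/rowP => i; rewrite mxE /eigen dE mxE eqxx mulr1n.
Qed.

Lemma eigenM g h i : g \in G -> h \in G ->
  eigen (g \o h)%VF i = eigen g i * eigen h i.
Proof.
move=> gG hG; rewrite {1}/eigen conj_mxM (conj_mxE gG) (conj_mxE hG).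
by rewrite mulmx_diag !mxE eqxx mulr1n.
Qed.

Lemma eigen_exp g N i : g \in G -> lfun_mx g ^+ N = 1 -> eigen g i ^+ N = 1.
Proof.
move=> gG /conj_mx_exp; rewrite conj_mxE //.
have -> j : diag_mx (\row_i eigen g i) ^+ j = diag_mx (\row_i (eigen g i ^+ j)).
  elim: j => [|j IH].
    by apply/matrixP => a b; rewrite expr0 !mxE expr0.
  rewrite exprS IH -mulmxE mulmx_diag; congr diag_mx.
  by apply/rowP => a; rewrite !mxE exprS.
by move/matrixP/(_ i i); rewrite !mxE eqxx !mulr1n.
Qed.

(** Determinant one enters here; it will make the product of the eigencoordinates invariant. *)
Lemma eigen_prod g : g \in G -> \prod_i eigen g i = 1.
Proof.
move=> gG; rewrite -det_trig ?is_diag_mx_is_trig ?Pdiag //.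
rewrite /conj_mx det_mulmx mulrC -det_mulmx mulKmx //.
exact: (det_lfun_mx slG gG).
Qed.

Lemma eigen_neq0 g i : g \in G -> eigen g i != 0.
Proof.
move=> /eigen_prod; rewrite (bigD1 i) //=; apply: contra_eqN => /eqP ->.
by rewrite mul0r eq_sym oner_eq0.
Qed.

(** The action passes through the inverse of g and scales the i-th eigencoordinate by the inverse of
    [eigen g i]; the inverse in g.f = chi(g)^-1 f compensates, so no inverse appears here. *)
Definition wt_fun (m : 'X_{1..\dim {:V}}) : {ffun G -> k} :=
  [ffun g => \prod_i eigen (fsval g) i ^+ m i].

Lemma wt_funP m : is_character (wt_fun m).
Proof.
apply/andP; split; apply/forallP => g.
  rewrite ffunE; apply/prodf_neq0 => i _; apply: expf_neq0.
  exact/eigen_neq0/fsvalP.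
apply/forallP => h; apply/forallP => gh; apply/implyP => /eqP ghE.
rewrite !ffunE ghE -big_split /=; apply/eqP/eq_bigr => i _.
by rewrite eigenM ?fsvalP // exprMn.
Qed.

Definition wt m : character G := Character (wt_funP m).

Lemma wtE m (g : G) : wt m g = \prod_i eigen (fsval g) i ^+ m i.
Proof. exact: ffunE. Qed.

Lemma character_eqP (chi psi : character G) : chi =1 psi <-> chi = psi.
Proof. by split=> [e|-> //]; apply/val_inj/ffunP. Qed.

Lemma wtM m m' (g : G) : wt (m + m')%MM g = wt m g * wt m' g.
Proof.
rewrite !wtE -big_split; apply: eq_bigr => i _.
by rewrite mnmDE exprD.
Qed.

(** With A the matrix of g and D = P A P^-1, this is the identity P A^-1 = D^-1 P. *)
Lemma act_eigenbasis g f : g \in G ->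
  act g (f \mPo lin_tuple P) =
  (f \mPo lin_tuple (diag_mx (\row_i (eigen g i)^-1))) \mPo lin_tuple P.
Proof.
move=> gG; have -> : act g = fun p => p \mPo lin_tuple (lfun_mx g^-1%VF).
  apply: funext => p; rewrite /act; congr (_ \mPo _).
  apply/eq_from_tnth => i; rewrite !tnth_mktuple; apply: eq_bigr => j _.
  by rewrite mxE.
rewrite !comp_lin_tuple; congr (_ \mPo lin_tuple _).
have gU := lfun_mx_unit slG gG.
rewrite lfun_mxV //; apply: (can_inj (mulmxK gU)).
rewrite mulmxKV // -mulmxA -[P *m lfun_mx g](mulmxKV PU) -/(conj_mx g).
rewrite conj_mxE // mulmxA mulmx_diag -[LHS]mul1mx; congr (_ *m _).
apply/matrixP => i j; rewrite !mxE mulVf ?eigen_neq0 //.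
Qed.

(** In eigencoordinates g multiplies the coefficient of the monomial m by the inverse of [wt m g];
    compare coefficients. *)
Lemma semi_invariant_wt (chi : character G) f :
  f \in semi_invariant chi <->
  (forall m, m \in msupp (f \mPo lin_tuple (invmx P)) -> wt m = chi).
Proof.
set tau := lin_tuple (invmx P).
have PK p : (p \mPo tau) \mPo lin_tuple P = p.
  by rewrite comp_lin_tuple mulVmx // lin_tuple1 comp_mpoly_id.
have KP p : (p \mPo lin_tuple P) \mPo tau = p.
  by rewrite comp_lin_tuple mulmxV // lin_tuple1 comp_mpoly_id.
have actE (g : G) m :
    (act (fsval g) f \mPo tau)@_m = (f \mPo tau)@_m * (wt m g)^-1.
  rewrite -{1}(PK f) act_eigenbasis ?fsvalP // KP comp_diag_mcoeff wtE.
  congr (_ * _); rewrite -prodfV; apply: eq_bigr => i _.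
  by rewrite mxE exprVn.
split=> [/semi_invariantP sf m|sf].
  rewrite mcoeff_msupp => fm; apply/character_eqP => g.
  have := actE g m; rewrite sf comp_mpolyZ mcoeffZ mulrC => /(mulfI fm).
  by move/invr_inj.
apply/semi_invariantP => g; rewrite -[LHS]PK -[in RHS](PK f).
rewrite -comp_mpolyZ; congr (_ \mPo _); apply/mpolyP => m.
rewrite actE mcoeffZ mulrC.
have [/sf -> //|] := boolP (m \in msupp (f \mPo tau)).
by move=> /memN_msupp_eq0 ->; rewrite !mulr0.
Qed.

End WeightGrading.

Lemma weight_grading_exists (k : closedFieldType) (V : vectType k)
    (G : {fset 'End(V)}) :
  [pchar k] =i pred0 -> is_subgroup_SL G -> is_abelian G ->
  inhabited (weight_grading G).
Proof.
move=> k0 slG abG.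
have [P PU Pdiag] := simultaneous_diagonalization k0 slG abG.
have [N GN] := lfun_mx_order slG.
have trivE : wt slG PU Pdiag 0%MM = trivial_char G.
  apply/character_eqP => g; rewrite wtE ffunE big1 // => i _.
  by rewrite mnm0E expr0.
have wtN a : wt slG PU Pdiag (a *+ N.+1)%MM = wt slG PU Pdiag 0%MM.
  rewrite trivE; apply/character_eqP => g; rewrite wtE ffunE big1 // => i _.
  by rewrite mulmnE mulnC exprM (eigen_exp PU Pdiag) ?fsvalP ?GN ?expr1n ?fsvalP.
have wt1 : wt slG PU Pdiag (\sum_i U_(i))%MM = wt slG PU Pdiag 0%MM.
  rewrite trivE; apply/character_eqP => g; rewrite wtE ffunE.
  rewrite -[RHS](eigen_prod slG PU Pdiag (fsvalP g)); apply: eq_bigr => i _.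
  rewrite mnm_sumE (bigD1 i) //= mnm1E eqxx big1 ?addn0 ?expr1 // => j.
  by rewrite mnm1E => /negbTE ->.
constructor; refine (@WeightGrading k V G
  (@comp_mpoly _ _ _ (lin_tuple (invmx P))) (@comp_mpoly _ _ _ (lin_tuple P))
  _ _ (wt slG PU Pdiag) N _ trivE wtN wt1 _).
- by move=> p /=; rewrite comp_lin_tuple mulVmx // lin_tuple1 comp_mpoly_id.
- by move=> p /=; rewrite comp_lin_tuple mulmxV // lin_tuple1 comp_mpoly_id.
- move=> a a' b b' aa bb; apply/character_eqP => g.
  by rewrite !wtM aa bb.
- exact: semi_invariant_wt.
Qed.

(** * Maps between modules of semi-invariants *)

Section HomogeneousMaps.
Variables (k : fieldType) (V : vectType k) (G : {fset 'End(V)}).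
Local Notation S := (invariants G).
Local Notation R := (coord_ring V).
Implicit Types (chi psi : character G) (p q r : R) (x y : Mhat G).

Lemma invariant_trivial p :
  (p \in Defs.invariant G) = (p \in semi_invariant (trivial_char G)).
Proof.
apply/invariantP/semi_invariantP => h g; rewrite h /= ffunE invr1 scale1r //.
Qed.

Lemma Mhat_eqP x y : (forall chi, val (x chi) = val (y chi)) -> x = y.
Proof. by move=> xy; apply/dirsum_eqP => chi; apply/val_inj. Qed.

Lemma coord_semi chi x : val (x chi) \in semi_invariant chi.
Proof. exact: (valP (x chi)). Qed.

Fact single_finitely_supported chi p : finitely_supported
  (fun psi : character G =>
     if psi == chi then insubd (0 : semi_invariants psi) p else 0).
Proof. by exists [:: chi] => psi; rewrite inE => /negbTE ->. Qed.

(** Total in [p]: outside M_chi the default value of [insubd] gives 0. *)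
Definition single chi p : Mhat G := DirSum (single_finitely_supported chi p).

Lemma singleE chi p psi : p \in semi_invariant chi ->
  val (single chi p psi) = if psi == chi then p else 0.
Proof. by move=> pchi /=; case: eqVneq => // ->; rewrite insubdK. Qed.

Lemma singleK chi p : p \in semi_invariant chi -> val (single chi p chi) = p.
Proof. by move=> pchi; rewrite (singleE chi pchi) eqxx. Qed.

Lemma coordD chi x y : val ((x + y) chi) = val (x chi) + val (y chi).
Proof. by []. Qed.

Lemma coordZ chi (s : S) x : val ((s *: x) chi) = val s * val (x chi).
Proof. by []. Qed.

Lemma singleD chi p q : p \in semi_invariant chi -> q \in semi_invariant chi ->
  single chi (p + q) = single chi p + single chi q.
Proof.
move=> pchi qchi; apply/Mhat_eqP => psi.
have pqchi : p + q \in semi_invariant chi.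
  exact: (valP (SemiInvariant pchi + SemiInvariant qchi)).
rewrite (singleE psi pqchi) (coordD psi (single chi p) (single chi q)).
rewrite [X in _ = X + _](singleE psi pchi) [X in _ = _ + X](singleE psi qchi).
by case: eqP => _; rewrite ?addr0.
Qed.

Lemma single_proj chi x : summand_proj chi x = single chi (val (x chi)).
Proof.
apply/Mhat_eqP => psi; rewrite singleE ?coord_semi //=.
by case: eqVneq => // ->.
Qed.

Lemma singleZ chi (s : S) p : p \in semi_invariant chi ->
  s *: single chi p = single chi (val s * p).
Proof.
move=> pchi; have sp : val s * p \in semi_invariant chi.
  exact: (semi_invariant_scaleP s (SemiInvariant pchi)).
apply/Mhat_eqP => psi; rewrite singleE //=; case: eqVneq => [->|_].
  by rewrite insubdK.
by rewrite mulr0.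
Qed.

Lemma LambdaP (f : Mhat G -> Mhat G) : linear f ->
  exists T : Lambda G, forall x, end_fun T x = f x.
Proof.
move=> fl.
pose F : {linear Mhat G -> Mhat G} :=
  HB.pack f (GRing.isLinear.Build S (Mhat G) (Mhat G) *:%R f fl).
by exists (end_mk F).
Qed.

Lemma Lambda_scale (T : Lambda G) (s : S) x : end_fun T (s *: x) = s *: end_fun T x.
Proof. by rewrite /end_fun linearZ. Qed.

Lemma mul_mapP chi psi q :
  (forall p, p \in semi_invariant chi -> q * p \in semi_invariant psi) ->
  exists T : Lambda G, forall x, end_fun T x = single psi (q * val (x chi)).
Proof.
move=> qM; apply: (@LambdaP (fun x => single psi (q * val (x chi)))) => s x y.
have M (z : Mhat G) : q * val (z chi) \in semi_invariant psi.
  exact: qM (coord_semi chi z).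
have sM : val s * (q * val (x chi)) \in semi_invariant psi.
  exact: (semi_invariant_scaleP s (SemiInvariant (M x))).
rewrite (singleZ s (M x)) -(singleD sM (M y)); congr (single _ _).
by rewrite coordD coordZ mulrDr mulrCA.
Qed.

Variable W : weight_grading G.
Local Notation chr := (wg_chr W).
Local Notation to := (wg_to W).
Local Notation of_ := (wg_of W).
Local Notation N := (wg_exp W).
Implicit Types a b m : 'X_{1..\dim {:V}}.

Let chrD := @wg_chrD _ _ _ W.
Let chrN := @wg_chrN _ _ _ W.
Let semiP chi p : p \in semi_invariant chi <->
  (forall m, m \in msupp (to p) -> chr m = chi) := wg_semi W chi p.

Definition mon a : R := of_ 'X_[a].

Lemma to_mon a : to (mon a) = 'X_[a].
Proof. exact: wg_ofK. Qed.

Lemma monD a b : mon (a + b)%MM = mon a * mon b.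
Proof. by rewrite /mon mpolyXD rmorphM. Qed.

Lemma mon_neq0 a : mon a != 0.
Proof.
apply/eqP => /(congr1 to); rewrite to_mon rmorph0.
by move/mpolyP/(_ a)/eqP; rewrite mcoeffX eqxx mcoeff0 oner_eq0.
Qed.

Lemma mon_semi a : mon a \in semi_invariant (chr a).
Proof. by apply/semiP => m; rewrite to_mon msuppX inE => /eqP ->. Qed.

Lemma semi_invariantM a b p q : p \in semi_invariant (chr a) ->
  q \in semi_invariant (chr b) -> p * q \in semi_invariant (chr (a + b)%MM).
Proof.
move=> /semiP pa /semiP qb; apply/semiP => m; rewrite rmorphM => /msuppM_le.
by case/allpairsP => -[m1 m2] /= [/pa m1a /qb m2b ->]; apply: chrD.
Qed.

Lemma semi_invariant_chr chi p : p \in semi_invariant chi -> p != 0 ->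
  exists a, chi = chr a.
Proof.
move=> /semiP pchi p0; have : msupp (to p) != [::].
  by rewrite msupp_eq0; apply: contraNneq p0 => p0; rewrite -(wg_toK W p) p0 rmorph0.
case E : (msupp (to p)) => [//|m l] _; exists m; apply/esym/pchi.
by rewrite E inE eqxx.
Qed.

(** Multiplication by [mon a] translates the support by [a], which [chr_addI] cancels. *)
Lemma semi_invariant_div a c p : p * mon a \in semi_invariant (chr (c + a)%MM) ->
  p \in semi_invariant (chr c).
Proof.
move=> /semiP pa; apply/semiP => m mp; apply: (chr_addI chrD chrN (c := a)).
rewrite !(addmC a); apply: pa.
by rewrite rmorphM /= to_mon mcoeff_msupp addmC mcoeffMX -mcoeff_msupp.
Qed.

(* The product of all variables is invariant, so the character of each variable
   is that of a power of the product of the others. *)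
Lemma chr_avoid i a : exists2 b : 'X_{1..\dim {:V}}, b i = 0%N & chr b = chr a.
Proof.
pose d := ((\sum_j U_(j)) - U_(i))%MM.
have ds : (d + U_(i) = \sum_j U_(j))%MM.
  rewrite submK // lep1mP mnm_sumE (bigD1 i) //= mnm1E eqxx //.
have di : d i = 0%N.
  rewrite mnmBE mnm_sumE (bigD1 i) //= mnm1E eqxx big1 // => j.
  by rewrite mnm1E => /negbTE ->.
have dN : chr (d *+ N)%MM = chr U_(i)%MM.
  apply: (chr_addI chrD chrN (c := d)).
  by rewrite -mulmS chrN ds (wg_chr_prod W).
(* Each factor of the i-th variable in [a] is traded for [d *+ N], which has the same character and
   avoids that variable. *)
exists (a - U_(i) *+ a i + d *+ N *+ a i)%MM.
  by rewrite mnmDE mnmBE !mulmnE mnm1E eqxx di mul1n subnn !mul0n.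
have le : (U_(i) *+ a i <= a)%MM.
  apply/mnm_lepP => j; rewrite mulmnE mnm1E.
  by case: eqVneq => [->|_]; rewrite ?mul1n ?mul0n.
rewrite -[in RHS](submK le); apply: chrD => //.
exact: (chrMn chrD).
Qed.

Lemma mpolyX_dvd (u : {mpoly k[\dim {:V}]}) a :
  (forall m, m \in msupp u -> (a <= m)%MM) -> exists v, u = v * 'X_[a].
Proof.
move=> ua; exists (\sum_(m <- msupp u) u@_m *: 'X_[m - a]).
rewrite mulr_suml [LHS]mpolyE [LHS]big_seq [RHS]big_seq.
apply: eq_bigr => m /ua am.
by rewrite -scalerAl -mpolyXD submK.
Qed.

(* By chr_avoid, M_(chr a) contains for each i a monomial prime to the i-th
   variable; comparing h there and at mon a shows that mon a divides
   h (mon a), the quotient being r. *)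
Lemma homogeneous_map_mul a psi (h : R -> R) :
  (forall p, p \in semi_invariant (chr a) -> h p \in semi_invariant psi) ->
  (forall (s : S) p, p \in semi_invariant (chr a) -> h (val s * p) = val s * h p) ->
  exists r, forall p, p \in semi_invariant (chr a) -> h p = r * p.
Proof.
move=> hM hZ.
have inv_chr b c p q : chr (b + c)%MM = chr 0%MM ->
    p \in semi_invariant (chr b) -> q \in semi_invariant (chr c) ->
    exists s : S, val s = p * q.
  move=> bc pb qc; have sI : p * q \in Defs.invariant G.
    by rewrite invariant_trivial -(wg_chr0 W) -bc; exact: semi_invariantM.
  by exists (Invariant sI).
have aN : chr (a *+ N + a)%MM = chr 0%MM by rewrite -mulmSr chrN.
(* Times [mon (a *+ N)], both [mon a] and [p] become invariant and can be pulled out of [h]; the two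
   sides are then the same value of [h]. *)
have hE p : p \in semi_invariant (chr a) -> h p * mon a = h (mon a) * p.
  move=> pa; apply: (mulfI (mon_neq0 (a *+ N)%MM)).
  have [s sE] := inv_chr _ _ _ _ aN (mon_semi _) (mon_semi a).
  have [t tE] := inv_chr _ _ _ _ aN (mon_semi _) pa.
  have := hZ s p pa; have := hZ t (mon a) (mon_semi a).
  by rewrite sE tE mulrAC [h (mon a) * p]mulrC [h p * mon a]mulrC !mulrA => -> ->.
have [v vE] : exists v, to (h (mon a)) = v * 'X_[a].
  apply: mpolyX_dvd => m; rewrite mcoeff_msupp => hm; apply/mnm_lepP => i.
  have [b bi ba] := chr_avoid i a.
  have mb : mon b \in semi_invariant (chr a) by rewrite -ba mon_semi.
  have := congr1 to (hE _ mb); rewrite !rmorphM /= !to_mon.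
  move=> /mpolyP /(_ (b + m)%MM).
  rewrite mcoeffMX => e; move: hm; rewrite -e -mcoeff_msupp => /msuppM_le.
  case/allpairsP => -[m1 m2] /= [_]; rewrite msuppX inE => /eqP -> /mnmP /(_ i).
  by rewrite !mnmDE bi add0n => ->; rewrite leq_addl.
exists (of_ v) => p pa; apply: (mulIf (mon_neq0 a)); rewrite hE //.
rewrite -(wg_toK W (h (mon a))) vE rmorphM -/(mon a).
by rewrite -!mulrA [mon a * p]mulrC.
Qed.

Lemma Lambda_component a psi (T : Lambda G) :
  exists r, forall p, p \in semi_invariant (chr a) ->
    val (end_fun T (single (chr a) p) psi) = r * p.
Proof.
apply: (@homogeneous_map_mul a psi
  (fun p => val (end_fun T (single (chr a) p) psi))) => [p _|s p pa].
  exact: coord_semi.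
by rewrite -singleZ // Lambda_scale.
Qed.

Lemma mul_semi_invariant_inj a r r' :
  (forall p, p \in semi_invariant (chr a) -> r * p = r' * p) -> r = r'.
Proof. by move=> /(_ _ (mon_semi a)) /(mulIf (mon_neq0 a)). Qed.

Lemma Lambda_eqP (T U : Lambda G) :
  (forall x chi, val (end_fun T x chi) = val (end_fun U x chi)) -> T = U.
Proof. by move=> TU; apply/end_eqP => x; apply: Mhat_eqP => chi; apply: TU. Qed.

Definition proj chi : Lambda G := end_mk (summand_proj chi).

Lemma end_fun_proj chi x : end_fun (proj chi) x = single chi (val (x chi)).
Proof. exact: single_proj. Qed.

(** A product A e B factors through S: B contributes its multiplier into S, of character inverse to
    [chr a], and A, being S-linear, contributes its value at 1. *)
Lemma LeL_component a psi (T : Lambda G) : LeL G T ->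
  exists2 s : seq (R * R),
    forall pq, pq \in s -> pq.1 \in semi_invariant (chr (a *+ N)%MM) /\
                           pq.2 \in semi_invariant psi &
    forall p, p \in semi_invariant (chr a) ->
      val (end_fun T (single (chr a) p) psi) = (\sum_(pq <- s) pq.1 * pq.2) * p.
Proof.
move=> [l ->]; elim: l => [|[A B] l [s sM sE]].
  by exists [::] => // p _; rewrite !big_nil mul0r.
have [r rE] := Lambda_component a (trivial_char G) B.
pose q := val (end_fun A (single (trivial_char G) 1) psi).
have t1 : 1 \in semi_invariant (trivial_char G).
  rewrite -invariant_trivial; apply/invariantP => g; exact: rmorph1.
exists ((r, q) :: s) => [pq|p pa].
  rewrite inE => /predU1P [->|/sM //] /=; split; last exact: coord_semi.
  apply: (@semi_invariant_div a); rewrite -mulmSr chrN (wg_chr0 W).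
  by rewrite -(rE _ (mon_semi a)); exact: coord_semi.
rewrite !big_cons mulrDl -sE //=.
have rpI : r * p \in Defs.invariant G.
  by rewrite invariant_trivial -(rE _ pa); exact: coord_semi.
have -> : r * q * p = val (end_fun A (single (trivial_char G) (r * p)) psi).
  have := singleZ (Invariant rpI) t1; rewrite /= mulr1 => <-.
  by rewrite Lambda_scale /= mulrAC.
rewrite -rE // -end_fun_proj.
by [].
Qed.

Lemma LeL_msupp a psi (T : Lambda G) r m : LeL G T ->
  (forall p, p \in semi_invariant (chr a) ->
     val (end_fun T (single (chr a) p) psi) = r * p) ->
  m \in msupp (to r) ->
  exists b b', [/\ m = (b + b')%MM, chr b = chr (a *+ N)%MM & chr b' = psi].
Proof.
move=> /(LeL_component a psi) [s sM sE] rE.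
have -> : r = \sum_(pq <- s) pq.1 * pq.2.
  by apply: (@mul_semi_invariant_inj a) => p pa; rewrite -sE // rE.
rewrite rmorph_sum /= mcoeff_msupp raddf_sum /= => sm.
have [pq pqs] : exists2 pq, pq \in s & (to (pq.1 * pq.2))@_m != 0.
  apply: contrapT => h; move: sm; rewrite big_seq big1 ?eqxx // => pq pqs.
  by apply/eqP; apply: contrapT => /negP pqm; apply: h; exists pq.
rewrite -mcoeff_msupp rmorphM => /msuppM_le /allpairsP [[b b'] /= [bp b'q ->]].
have [/semiP pM /semiP qM] := sM _ pqs.
by exists b, b'; split=> //; [exact: pM|exact: qM].
Qed.

(** Multiplication by c [mon b'] maps M_(chr a) into S, and [mon b] maps S back to M_(chr a). *)
Lemma LeL_mul_proj a b b' (s : S) :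
  chr b = chr a -> chr (b + b')%MM = chr 0%MM ->
  (exists c, val s = c *: mon (b + b')%MM) -> LeL G (phi G s * proj (chr a)).
Proof.
move=> ba bb' [c sE].
have bM p : p \in semi_invariant (trivial_char G) ->
    mon b * p \in semi_invariant (chr a).
  rewrite -(wg_chr0 W) -ba => p0; rewrite -[X in chr X](addm0 b).
  exact: semi_invariantM (mon_semi b) p0.
have b'M p : p \in semi_invariant (chr a) ->
    c *: mon b' * p \in semi_invariant (trivial_char G).
  move=> pa; have b'p : mon b' * p \in semi_invariant (chr (b' + b)%MM).
    by apply: semi_invariantM; rewrite ?mon_semi ?ba.
  rewrite -(wg_chr0 W) -bb' addmC; apply/semiP => m; rewrite -scalerAl linearZ.
  by move=> /msuppZ_le; have /semiP := b'p; apply.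
have [A AE] := mul_mapP bM; have [B BE] := mul_mapP b'M.
exists [:: (A, B)]; rewrite big_seq1; apply/end_eqP => x.
set u := c *: mon b' * val (x (chr a)).
have uM : u \in semi_invariant (trivial_char G) := b'M _ (coord_semi _ x).
transitivity (single (chr a) (mon b * u)).
  transitivity (s *: end_fun (proj (chr a)) x); first by [].
  rewrite end_fun_proj (singleZ s (coord_semi _ x)) sE; congr (single _ _).
  by rewrite /u monD -!scalerAl -scalerAr mulrA.
transitivity (end_fun A (end_fun (proj (trivial_char G)) (end_fun B x))); last by [].
rewrite (BE x) -/u (end_fun_proj (trivial_char G)) (singleK uM).
by rewrite (AE (single _ _)) (singleK uM).
Qed.

End HomogeneousMaps.

(** * Central elements modulo Lambda e Lambda *)

Section CentralElements.
Variables (k : fieldType) (V : vectType k) (G : {fset 'End(V)}).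
Variable W : weight_grading G.
Local Notation S := (invariants G).
Local Notation R := (coord_ring V).
Local Notation chr := (wg_chr W).
Local Notation to := (wg_to W).
Local Notation of_ := (wg_of W).
Local Notation N := (wg_exp W).
Implicit Types (chi psi : character G) (p q r : R) (x y : Mhat G).
Implicit Types a b m : 'X_{1..\dim {:V}}.

Let chrD := @wg_chrD _ _ _ W.
Let chrN := @wg_chrN _ _ _ W.
Let semiP chi p : p \in semi_invariant chi <->
  (forall m, m \in msupp (to p) -> chr m = chi) := wg_semi W chi p.

(** Exponents can be reduced modulo [N.+1], so this finite list meets every character of a
    monomial. *)
Definition chr_reps : seq 'X_{1..\dim {:V}} :=
  [seq [multinom val (f i) | i < \dim {:V}]
  | f : {ffun 'I_(\dim {:V}) -> 'I_N.+1}].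

Lemma chr_repsP a : exists2 b, b \in chr_reps & chr b = chr a.
Proof.
exists [multinom (a i %% N.+1)%N | i < \dim {:V}].
  pose f : {ffun 'I_(\dim {:V}) -> 'I_N.+1} := [ffun i => inord (a i %% N.+1)].
  apply/mapP; exists f; first by rewrite mem_enum.
  by apply/mnmP => i; rewrite !mnmE ffunE /= inordK // ltn_pmod.
pose d := [multinom (a i %/ N.+1)%N | i < \dim {:V}].
have aE : a = (d *+ N.+1 + [multinom (a i %% N.+1)%N | i < \dim {:V}])%MM.
  by apply/mnmP => i; rewrite mnmDE mulmnE !mnmE -divn_eq.
rewrite [in RHS]aE -[in LHS](add0m [multinom _ | i < _]).
by apply: chrD; rewrite ?chrN.
Qed.

(** A nonzero M_chi contains a monomial up to change of basis, so only the listed characters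
    contribute to the direct sum. *)
Lemma sum_proj : \sum_(chi <- undup (map chr chr_reps)) proj chi = 1 :> Lambda G.
Proof.
apply: Lambda_eqP => x psi.
have sE (l : seq (character G)) : uniq l ->
    val (end_fun (\sum_(chi <- l) proj chi : Lambda G) x psi) =
    if psi \in l then val (x psi) else 0.
  elim: l => [|chi l IH] /=; first by rewrite big_nil.
  move=> /andP [chil /IH {}IH]; rewrite big_cons inE.
  have -> : val (end_fun (proj chi + \sum_(j <- l) proj j : Lambda G) x psi) =
      val (end_fun (proj chi) x psi) +
      val (end_fun (\sum_(j <- l) proj j : Lambda G) x psi) by [].
  rewrite IH end_fun_proj singleE ?coord_semi //.
  case: eqVneq => [->|_] /=; last by rewrite add0r.
  by rewrite (negbTE chil) addr0.
rewrite sE ?undup_uniq // mem_undup; case: ifP => // /negP psiN.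
apply: contrapT => x0; apply: psiN.
have [|a ->] := semi_invariant_chr W (coord_semi psi x).
  by apply/eqP => x1; apply: x0; rewrite x1.
by have [b bR <-] := chr_repsP a; apply: map_f.
Qed.

Section OneCentralElement.
Variable z : Lambda G.
Hypothesis zC : forall T : Lambda G, LeL G (z * T - T * z).
Variable r : 'X_{1..\dim {:V}} -> R.
Hypothesis rE : forall a p, p \in semi_invariant (chr a) ->
  val (end_fun z (single (chr a) p) (chr a)) = r a * p.

Lemma diag_chr a b : chr a = chr b -> r a = r b.
Proof.
move=> ab; apply: (@mul_semi_invariant_inj _ _ _ W a) => p pa.
by rewrite -!rE -?ab.
Qed.

Lemma diag_trivial a m : m \in msupp (to (r a)) -> chr m = chr 0%MM.
Proof.
move: m; apply/semiP/(@semi_invariant_div _ _ _ W a).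
by rewrite add0m -rE ?mon_semi // coord_semi.
Qed.

(* Apply zC to multiplication by the i-th variable, as a map from M_(chr a) to
   M_(chr (a + U_i)). *)
Lemma diag_step a m i : ~ inW chr m a -> ~ inW chr m (a + U_(i))%MM ->
  (to (r a))@_m = (to (r (a + U_(i))%MM))@_m.
Proof.
move=> Wa Wai; pose psi := chr (a + U_(i))%MM.
have qM p : p \in semi_invariant (chr a) ->
    mon W U_(i) * p \in semi_invariant psi.
  by rewrite mulrC => pa; apply: semi_invariantM pa (mon_semi W _).
have [T TE] := mul_mapP qM.
have TzE p : p \in semi_invariant (chr a) ->
    val (end_fun (z * T - T * z) (single (chr a) p) psi) =
    (r (a + U_(i))%MM - r a) * mon W U_(i) * p.
  move=> pa.
  have -> : val (end_fun (z * T - T * z) (single (chr a) p) psi) =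
     val (end_fun z (end_fun T (single (chr a) p)) psi) -
     val (end_fun T (end_fun z (single (chr a) p)) psi) by [].
  have rpa : r a * p \in semi_invariant (chr a).
    by rewrite -(rE pa); exact: coord_semi.
  have zTE : val (end_fun z (end_fun T (single (chr a) p)) psi) =
      r (a + U_(i))%MM * (mon W U_(i) * p).
    by rewrite (TE (single _ _)) (singleK pa) (rE (qM _ pa)).
  have TzE : val (end_fun T (end_fun z (single (chr a) p)) psi) =
      mon W U_(i) * (r a * p).
    by rewrite (TE (end_fun z _)) (rE pa) (singleK (qM _ rpa)).
  by rewrite zTE TzE !mulrBl !mulrA [_ * r a]mulrC.
(* If the coefficients differ, m + U_i occurs in the multiplier of the commutator, so it is b + b'
   with [chr b] inverse to [chr a] and [chr b'] equal to [psi]. *)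
apply/eqP; apply: contrapT => /negP neq.
have mU : (m + U_(i))%MM \in msupp (to ((r (a + U_(i))%MM - r a) * mon W U_(i))).
  rewrite rmorphM /= to_mon mcoeff_msupp addmC mcoeffMX raddfB /= mcoeffB.
  by rewrite subr_eq0 eq_sym.
have [b [b' [mE bE b'E]]] := LeL_msupp (zC T) TzE mU.
(* As b + b' exceeds m by one i-th variable only, b or b' divides m; this puts [a], respectively
   [a + U_(i)], in W_m. *)
have cases : (b <= m)%MM \/ (b' <= m)%MM.
  have /mnmP/(_ i) := mE; rewrite !mnmDE mnm1E eqxx addn1 => mi.
  have hj j : j != i -> m j = (b j + b' j)%N.
    move=> ji; have /mnmP/(_ j) := mE.
    by rewrite !mnmDE mnm1E eq_sym (negbTE ji) addn0.
  have [bi|bi] := leqP (b i) (m i).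
    left; apply/mnm_lepP => j; have [->//|/hj ->] := eqVneq j i.
    exact: leq_addr.
  right; apply/mnm_lepP => j; have [->|/hj ->] := eqVneq j i; last exact: leq_addl.
  by rewrite -(leq_add2l (b i)) -mi (leq_trans bi) ?leq_addr.
case: cases => /lem_supp_sub Wb; last by apply: Wai; exists b'.
apply: Wa; apply: (inW_inv chrD chrN (b := b)); last by exists b.
by rewrite -[RHS](chrN a) mulmS; apply: chrD.
Qed.

Lemma diag_common_value m :
  exists v, forall a, ~ inW chr m a -> (to (r a))@_m = v.
Proof.
have [[a Wa]|no] := pselect (exists a, ~ inW chr m a); last first.
  (* When W_m contains every character of a monomial, the condition is empty and 0 is an arbitrary
     choice. *)
  by exists 0 => a Wa; case: no; exists a.
exists (to (r a))@_m => b Wb.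
apply: (c_const chrD chrN (c := fun a => (to (r a))@_m)) Wb Wa => [c d|c i].
  by move=> /diag_chr ->.
exact: diag_step.
Qed.

(** The coefficients of s are the common values. Only monomials occurring in some [r b] with [b] in
    [chr_reps] are kept, so that s is a polynomial; at the others every [r a] has coefficient 0. *)
Lemma diag_approximation : exists s : S, forall a m,
  m \in msupp (to (r a - val s)) -> inW chr m a.
Proof.
have [v vE] := choice diag_common_value.
pose l := undup (flatten [seq (msupp (to (r a)) : seq _) | a <- chr_reps]).
pose s0 : {mpoly k[\dim {:V}]} := \sum_(m <- l) v m *: 'X_[m].
have s0E m : s0@_m = if m \in l then v m else 0.
  rewrite raddf_sum /=.
  have -> : \sum_(i <- l) (v i *: 'X_[i])@_m = \sum_(i <- l) v i * (i == m)%:R.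
    by apply: eq_bigr => i _; rewrite mcoeffZ mcoeffX.
  case: ifP => [ml|/negP ml].
    rewrite (bigD1_seq m) ?undup_uniq //= eqxx mulr1 big1 ?addr0 // => i.
    by move=> /negbTE ->; rewrite mulr0.
  rewrite big_seq big1 // => i il; case: eqVneq => [im|_]; last by rewrite mulr0.
  by case: ml; rewrite -im.
have sI : of_ s0 \in Defs.invariant G.
  rewrite invariant_trivial; apply/semiP => m; rewrite wg_ofK mcoeff_msupp s0E.
  case: ifP => [|_]; last by rewrite eqxx.
  rewrite mem_undup => /flatten_mapP [a _ /diag_trivial -> _].
  exact: wg_chr0.
exists (Invariant sI) => a m; rewrite raddfB /= wg_ofK.
have [b bR ba] := chr_repsP a.
rewrite -(diag_chr ba) mcoeff_msupp mcoeffB => h.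
apply: contrapT => Wa.
have Wb : ~ inW chr m b by move=> Wb; apply: Wa; apply: inW_chr Wb.
move: h; rewrite s0E; case: ifP => [_|/negP ml].
  by rewrite (vE _ _ Wb) subrr eqxx.
rewrite subr0 -mcoeff_msupp => mb; apply: ml.
by rewrite mem_undup; apply/flatten_mapP; exists b.
Qed.

End OneCentralElement.

(** The s in S that act on M_(chr a) through Lambda e Lambda form an ideal [J]. Its radical contains
    each term of [t], hence [t]. *)
Lemma LeL_mul_pow a (t : S) : (forall m, m \in msupp (to (val t)) -> inW chr m a) ->
  exists L, LeL G (phi G t ^+ L * proj (chr a)).
Proof.
move=> tW.
have J0 : LeL G (phi G 0 * proj (chr a)) by rewrite rmorph0 mul0r; exact: ideal0.
have JD s t' : LeL G (phi G s * proj (chr a)) -> LeL G (phi G t' * proj (chr a)) ->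
    LeL G (phi G (s + t') * proj (chr a)).
  by rewrite rmorphD mulrDl; exact: idealD.
have JM s t' : LeL G (phi G t' * proj (chr a)) ->
    LeL G (phi G (s * t') * proj (chr a)).
  by rewrite rmorphM -mulrA; exact: idealMl.
have JMr t' s : LeL G (phi G s * proj (chr a)) ->
    LeL G (phi G (s * t') * proj (chr a)).
  by rewrite mulrC; exact: JM.
pose J : ideal S := @Ideal S (fun s => LeL G (phi G s * proj (chr a))) J0 JD JM JMr.
pose Q p := exists2 s : S, val s = p & radical (@mulrC S) J s.
suff [s /val_inj -> [L sL]] : Q (val t) by exists L; rewrite -rmorphXn.
rewrite -(wg_toK W (val t)) (mpolyE (to (val t))) rmorph_sum big_seq.
apply: (big_ind Q) => [|p q [s sp rs] [s' s'q rs']|m mt].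
- by exists 0; [exact: raddf0 | exact: ideal0].
- by exists (s + s'); [rewrite raddfD /= sp s'q | exact: idealD].
have m0 : chr m = chr 0%MM.
  move: m mt; rewrite (wg_chr0 W); apply/semiP; rewrite -invariant_trivial.
  exact: (valP t).
have mI : of_ ((to (val t))@_m *: 'X_[m]) \in Defs.invariant G.
  rewrite invariant_trivial -(wg_chr0 W) -m0; apply/semiP => m'.
  by rewrite wg_ofK => /msuppZ_le; rewrite msuppX inE => /eqP ->.
exists (Invariant mI) => //.
(* A monomial b of character [chr a] supported on m divides a power of m, so that power acts through
   Lambda e Lambda by [LeL_mul_proj]. *)
have [b bm ba] := tW m mt; have [j bj] := supp_sub_lem bm; exists j.
have bE : (b + (m *+ j - b) = m *+ j)%MM by rewrite addmC submK.
apply: (LeL_mul_proj (b := b) (b' := (m *+ j - b)%MM)) => //.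
  rewrite bE (chrMn chrD j m0); congr chr; elim: j {bj bE} => [|j IH].
    by rewrite mulm0n.
  by rewrite mulmS add0m.
exists ((to (val t))@_m ^+ j); rewrite rmorphXn /= bE.
by rewrite linearZ /= exprZn -rmorphXn mpolyXn.
Qed.

(** Modulo Lambda e Lambda, the difference [y] acts on each summand as multiplication by [t a],
    which is nilpotent there. *)
Lemma central_mod_nilpotent (z : Lambda G) :
  (forall T : Lambda G, LeL G (z * T - T * z)) ->
  exists s : S, exists L, LeL G ((z - phi G s) ^+ L).
Proof.
move=> zC.
have [r rE] := choice (fun a => Lambda_component W a (chr a) z).
have [s sE] := diag_approximation zC rE; exists s.
have rI a : r a \in Defs.invariant G.
  rewrite invariant_trivial -(wg_chr0 W); apply/semiP => m.
  exact: (diag_trivial rE).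
pose t a : S := Invariant (rI a) - s.
have tE a : val (t a) = r a - val s by rewrite raddfB.
have tP a : exists L, LeL G (phi G (t a) ^+ L * proj (chr a)).
  by apply: LeL_mul_pow => m; rewrite tE; exact: sE.
have [L LP] := choice tP.
pose y : Lambda G := z - phi G s.
have yC (T : Lambda G) : LeL G (y * T - T * y).
  by rewrite mulrBl mulrBr -end_scaleC opprB addrA subrK; exact: zC.
(* Since [y] commutes with [proj (chr a)] modulo Lambda e Lambda, only its diagonal entry survives
   on this summand. *)
have ye a : LeL G (y * proj (chr a) - phi G (t a) * proj (chr a)).
  suff -> : y * proj (chr a) - phi G (t a) * proj (chr a) =
     (y * proj (chr a) - proj (chr a) * y) * proj (chr a).
    by apply: Defs.idealMr; exact: yC.
  have singleE' x : single (chr a) (val (single (chr a) (val (x (chr a))) (chr a))) =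
      single (chr a) (val ((x : Mhat G) (chr a))).
    by rewrite singleE ?eqxx ?coord_semi.
  have e1 : y * proj (chr a) * proj (chr a) = y * proj (chr a).
    apply/end_eqP => x.
    rewrite -[LHS]/(end_fun y (end_fun (proj (chr a)) (end_fun (proj (chr a)) x))).
    rewrite -[RHS]/(end_fun y (end_fun (proj (chr a)) x)).
    by rewrite !end_fun_proj singleE'.
  have e2 : proj (chr a) * y * proj (chr a) = phi G (t a) * proj (chr a).
    apply/end_eqP => x.
    rewrite -[LHS]/(end_fun (proj (chr a)) (end_fun y (end_fun (proj (chr a)) x))).
    rewrite -[RHS]/(t a *: end_fun (proj (chr a)) x).
    rewrite !end_fun_proj singleZ ?coord_semi //; congr (single _ _).
    have -> : val (end_fun y (single (chr a) (val (x (chr a)))) (chr a)) =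
      val (end_fun z (single (chr a) (val (x (chr a)))) (chr a)) -
      val s * val (single (chr a) (val (x (chr a))) (chr a)) by [].
    by rewrite rE ?coord_semi // singleE ?coord_semi // eqxx tE mulrBl.
  by rewrite [in RHS]mulrBl e1 e2.
have ye_exp a j : LeL G (y ^+ j * proj (chr a) - phi G (t a) ^+ j * proj (chr a)).
  elim: j => [|j IH]; first by rewrite !expr0 subrr; exact: ideal0.
  have -> : y ^+ j.+1 * proj (chr a) - phi G (t a) ^+ j.+1 * proj (chr a) =
    y * (y ^+ j * proj (chr a) - phi G (t a) ^+ j * proj (chr a)) +
    phi G (t a) ^+ j * (y * proj (chr a) - phi G (t a) * proj (chr a)).
    rewrite -!rmorphXn !mulrBr !mulrA -exprS -end_scaleC addrA subrK.
    by rewrite -rmorphM -exprSr.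
  by apply: idealD; apply: idealMl.
(* Finitely many representatives suffice, so one exponent serves all summands. *)
pose K := (\max_(a <- chr_reps) L a)%N; exists K.
rewrite -[X in LeL G X]mulr1 -sum_proj mulr_sumr big_seq.
apply: (big_ind (LeL G)) => [||chi]; [exact: ideal0 | exact: idealD |].
rewrite mem_undup => /mapP [a aR ->].
rewrite -[X in LeL G X](subrK (phi G (t a) ^+ K * proj (chr a))).
apply: idealD; first exact: ye_exp.
have LK : (L a <= K)%N by apply: leq_bigmax_seq.
by rewrite -(subnK LK) exprD -mulrA; apply: idealMl.
Qed.

End CentralElements.

(** * The induced isomorphism *)

Lemma inj_surj_bijective (T U : Type) (f : T -> U) :
  injective f -> (forall y, exists x, f x = y) -> bijective f.
Proof.
move=> fI /choice [g gK]; exists g => // x.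
by apply: fI; rewrite gK.
Qed.

Lemma first_isomorphism (A B : pzRingType) (I : ideal A) (F : {rmorphism A -> B}) :
  (forall x, I x <-> F x = 0) -> (forall y, exists x, F x = y) ->
  exists2 f : {rmorphism Defs.quot_type I -> B},
    forall x, f (quot_map I x) = F x & bijective f.
Proof.
move=> kerF surjF.
pose f (x : Defs.quot_type I) : B := F (repr x).
have fE x : f (quot_map I x) = F x.
  apply/eqP; rewrite -subr_eq0 -rmorphB; apply/eqP/kerF/quot_mapE.
  exact: reprK.
have fB : zmod_morphism f.
  move=> x y; have [x0 ->] := quot_mapP x; have [y0 ->] := quot_mapP y.
  by rewrite -rmorphB !fE rmorphB.
have fM : monoid_morphism f.
  split=> [|x y]; first by rewrite -(rmorph1 F) -fE.
  have [x0 ->] := quot_mapP x; have [y0 ->] := quot_mapP y.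
  by rewrite -rmorphM !fE rmorphM.
pose f' : {rmorphism Defs.quot_type I -> B} :=
  HB.pack f (GRing.isZmodMorphism.Build (Defs.quot_type I) B f fB)
    (GRing.isMonoidMorphism.Build (Defs.quot_type I) B f fM).
exists f' => //; apply: inj_surj_bijective => [x y|y].
  have [x0 ->] := quot_mapP x; have [y0 ->] := quot_mapP y.
  rewrite /= !fE => xy; apply/quot_mapE/kerF.
  by rewrite rmorphB xy subrr.
by have [x <-] := surjF y; exists (quot_map I x); exact: fE.
Qed.

Section InducedMorphism.
Variables (k : fieldType) (V : vectType k) (G : {fset 'End(V)}).

Lemma subalg_phi_S (x : subalg (phi_S G)) : exists s, val x = phi G s.
Proof. by case: x => x /= /asboolP. Qed.

Lemma phi_S_con_center (x : subalg (phi_S G)) :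
  center (Lambda_con G) (quot_map (LeL G) (val x)).
Proof. by have [s ->] := subalg_phi_S x; exact: phi_con_center. Qed.

Definition to_center_red (x : subalg (phi_S G)) : center_red G :=
  quot_map (nilradical (@center_mulC k (Lambda_con G)))
    (subalg_elt (phi_S_con_center x)).

Lemma to_center_red_zmod : zmod_morphism to_center_red.
Proof.
move=> x y; rewrite /to_center_red -rmorphB; congr (quot_map _ _).
by apply: val_inj; rewrite /= rmorphB.
Qed.

Lemma to_center_red_monoid : monoid_morphism to_center_red.
Proof.
split=> [|x y]; rewrite /to_center_red -?(rmorph1 (quot_map _)) -?rmorphM;
  congr (quot_map _ _); apply: val_inj.
  exact: rmorph1.
exact: rmorphM.
Qed.

HB.instance Definition _ := GRing.isZmodMorphism.Build
  (subalg (phi_S G)) (center_red G) to_center_red to_center_red_zmod.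
HB.instance Definition _ := GRing.isMonoidMorphism.Build
  (subalg (phi_S G)) (center_red G) to_center_red to_center_red_monoid.

Lemma nilradical_center (c : subalg (center (Lambda_con G))) (z : Lambda G) :
  val c = quot_map (LeL G) z ->
  (nilradical (@center_mulC k (Lambda_con G)) c <-> exists n, LeL G (z ^+ n)).
Proof.
move=> cE; have E n : LeL G (z ^+ n) <-> c ^+ n = 0.
  have -> : LeL G (z ^+ n) <-> quot_map (LeL G) (z ^+ n) = quot_map (LeL G) 0.
    by rewrite quot_mapE subr0.
  have -> : quot_map (LeL G) (z ^+ n) = val (c ^+ n) by rewrite !rmorphXn /= cE.
  rewrite rmorph0.
  by split=> [e|->]; [apply: val_inj; rewrite e rmorph0 | rewrite rmorph0].
by split=> -[n /E cn]; exists n.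
Qed.

(** Both sides say that some power of [x] lies in Lambda e Lambda. *)
Lemma to_center_red_ker x :
  radical (@scalar_mulC k (invariants G) (Mhat G)) (contract (phi_S G) (LeL G)) x
  <-> to_center_red x = 0.
Proof.
rewrite -[0](rmorph0 (quot_map _)) quot_mapE subr0.
rewrite (@nilradical_center _ (val x)) //.
have E n : contract (phi_S G) (LeL G) (x ^+ n) <-> LeL G (val x ^+ n).
  by rewrite -rmorphXn.
by split=> -[n /E xn]; exists n.
Qed.

(** A lift z of a central class commutes with everything modulo Lambda e Lambda, so it differs from
    some [phi G s] by a nilpotent, which the reduction kills. *)
Lemma to_center_red_surj : weight_grading G ->
  forall y, exists x, to_center_red x = y.
Proof.
move=> W y; have [c ->] := quot_mapP y; have [z zE] := quot_mapP (val c).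
have zC (T : Lambda G) : LeL G (z * T - T * z).
  apply/quot_mapE; rewrite !rmorphM /= -zE.
  by case: c {zE} => c /= /asboolP; exact.
have [s sL] := central_mod_nilpotent W zC.
exists (subalg_elt (phi_mem s)); apply/esym/quot_mapE.
apply/(@nilradical_center _ (z - phi G s)) => //.
by rewrite [RHS]rmorphB [LHS]rmorphB /= -zE.
Qed.

Lemma center_red_of_alg (a : k) :
  center_red_of (in_alg (invariants G) a) = alg_map (center_red G) a.
Proof.
pose c : subalg (center (Lambda_con G)) :=
  alg_map (subalg (center (Lambda_con G))) a.
transitivity (quot_map (nilradical (@center_mulC k (Lambda_con G))) c);
  last by [].
have <- : subalg_elt (phi_con_center (in_alg (invariants G) a)) = c; last by [].
apply: val_inj.
by transitivity (quot_map (LeL G) (alg_map (Lambda G) a)).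
Qed.

End InducedMorphism.

Theorem theorem3p27 (k : closedFieldType) (V : vectType k)
    (G : {fset 'End(V)}) :
  [pchar k] =i pred0 -> is_subgroup_SL G -> is_abelian G ->
  exists f : {rmorphism phi_S_red G -> center_red G},
    algebra_iso f /\
    forall s : invariants G, f (phi_S_red_of s) = center_red_of s.
Proof.
move=> k0 slG abG; have [W] := weight_grading_exists k0 slG abG.
have [f fE f_bij] :=
  first_isomorphism (@to_center_red_ker k V G) (to_center_red_surj W).
have f_phi s : f (phi_S_red_of s) = center_red_of s.
  by rewrite fE; congr (quot_map _ _); apply: val_inj.
exists f; split => //; split => // a.
(* The scalars of k act through S, so k-linearity is a case of [f_phi]. *)
transitivity (f (phi_S_red_of (in_alg (invariants G) a))).
  by congr (f (quot_map _ _)); apply: val_inj.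
transitivity (center_red_of (in_alg (invariants G) a)); first exact: f_phi.
exact: center_red_of_alg.
Qed.
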